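(* Assume that $\begin{pmatrix}Q&L'\\L&R\end{pmatrix}$ is positive definite. Then the generalized algebraic Riccati equation (GARE) admits a solution $\bar P\in S^n_{++}$ if and only if there exists $P_0\in S^n_{++}$ such that $\phi(P_0)\leq 0$. In that case, for any $P\in S^n_{++}$ with $P\neq\bar P$, $$d_T(M_t(P),\bar P)\leq e^{-\alpha t}\,d_T(P,\bar P)\qquad\text{for all } t\geq 0,$$ for some $$\alpha\geq\frac{1-e^{-d_T(P,\bar P)}}{d_T(P,\bar P)}\;m\big((Q-L'R^{-1}L)/\bar P\big)>0.$$ In particular, the solution of the GARE is unique in $S^n_{++}$.
   Context: $S^n$ is the set of real symmetric $n\times n$ matrices, $S^n_{++}$ the positive definite ones; $\leq$ is the Loewner order; $'$ denotes transpose. For $X\in S^n$, $Y\in S^n_{++}$, $M(X/Y)=\inf\{t\in\mathbb{R}:X\leq tY\}$, $m(X/Y)=\sup\{t\in\mathbb{R}:X\geq tY\}$; the Thompson metric is $d_T(X,Y)=\log\max\{M(X/Y),M(Y/X)\}$ on $S^n_{++}$. $A,C\in\mathbb{R}^{n\times n}$, $B,D\in\mathbb{R}^{n\times k}$, $L\in\mathbb{R}^{k\times n}$, $Q\in S^n$, $R\in S^k$ are constant matrices, and $$\phi(P)=A'P+PA+C'PC+Q-(B'P+D'PC+L)'(R+D'PD)^{-1}(B'P+D'PC+L).$$ The GARE is the problem $\phi(P)=0$ with $R+D'PD$ positive definite. $M_t(P)$ is the value at time $t$ of the solution in $S^n_{++}$ of $\dot P=\phi(P)$ with initial value $P$ at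 time $0$. *)

(* Defs.v *)
From HB Require Import structures.
From mathcomp Require Import all_boot all_order all_algebra.
From mathcomp Require Import all_classical all_reals all_analysis.
Import Order.TTheory GRing.Theory Num.Theory.
Import numFieldNormedType.Exports.

Set Implicit Arguments.
Unset Strict Implicit.
Unset Printing Implicit Defensive.

Local Open Scope classical_set_scope.
Local Open Scope ring_scope.

Definition psdmx (K : realType) (n : nat) (X : 'M[K]_n) : Prop :=
  X \is symmetricmx /\ forall v : 'cV[K]_n, 0 <= (v^T *m X *m v) 0 0.

Definition posdefmx (K : realType) (n : nat) (X : 'M[K]_n) : Prop :=
  X \is symmetricmx /\
  forall v : 'cV[K]_n, v != 0 -> 0 < (v^T *m X *m v) 0 0.

Definition loewner_le (K : realType) (n : nat) (X Y : 'M[K]_n) : Prop :=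
  psdmx (Y - X).

(* M(X/Y) and m(X/Y). The real-valued inf and sup are the intended ones when
   X is symmetric, Y is positive definite and n > 0: both sets are then
   nonempty and bounded on the relevant side. *)
Definition ratio_inf (K : realType) (n : nat) (X Y : 'M[K]_n) : K :=
  inf [set t : K | loewner_le X (t *: Y)].

Definition ratio_sup (K : realType) (n : nat) (X Y : 'M[K]_n) : K :=
  sup [set t : K | loewner_le (t *: Y) X].

Definition thompson (K : realType) (n : nat) (X Y : 'M[K]_n) : K :=
  ln (Num.max (ratio_inf X Y) (ratio_inf Y X)).

Definition riccati (K : realType) (n k : nat) (A : 'M[K]_n) (B : 'M[K]_(n, k))
    (C : 'M[K]_n) (D : 'M[K]_(n, k)) (L : 'M[K]_(k, n)) (Q : 'M[K]_n)
    (R : 'M[K]_k) (P : 'M[K]_n) : 'M[K]_n :=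
  let N := B^T *m P + D^T *m P *m C + L in
  A^T *m P + P *m A + C^T *m P *m C + Q
    - N^T *m invmx (R + D^T *m P *m D) *m N.

Definition GARE_solution (K : realType) (n k : nat) (A : 'M[K]_n)
    (B : 'M[K]_(n, k)) (C : 'M[K]_n) (D : 'M[K]_(n, k)) (L : 'M[K]_(k, n))
    (Q : 'M[K]_n) (R : 'M[K]_k) (P : 'M[K]_n) : Prop :=
  riccati A B C D L Q R P = 0 /\ posdefmx (R + D^T *m P *m D).

(* X solves dX/dt = f(X), X(0) = P, on [0, +oo[ within the positive definite
   cone. X is a total function, unconstrained at negative times, so at t = 0
   the two-sided derivative is replaced by continuity within [0, +oo[; for
   continuous f this is the usual C^1 solution with one-sided derivative at 0. *)
Definition posdef_solution (K : realType) (n : nat) (f : 'M[K]_n -> 'M[K]_n)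
    (P : 'M[K]_n) (X : K -> 'M[K]_n) : Prop :=
  [/\ X 0 = P,
      forall t : K, 0 <= t -> posdefmx (X t),
      {within [set t : K | 0 <= t], continuous X} &
      forall t : K, 0 < t -> is_derive t (1 : K) X (f (X t))].

(* Main.v *)
Require Import Defs.
From HB Require Import structures.
From mathcomp Require Import all_boot all_order all_algebra.
From mathcomp Require Import all_classical all_reals all_analysis.
From mathcomp Require Import ring lra.
Import Order.TTheory GRing.Theory Num.Theory.
Import numFieldNormedType.Exports.

Set Implicit Arguments.
Unset Strict Implicit.
Unset Printing Implicit Defensive.

Local Open Scope classical_set_scope.
Local Open Scope ring_scope.

(** Write [phi_H P = F' P + P F + G' P G + W_H], with [F = A + B H],
    [G = C + D H] and [W_H = Q + L' H + H' L + H' R H], for the affine operator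
    attached to a feedback gain [H]. Completing the square in [H] shows that
    [phi P] is the minimum of the [phi_H P] in the Loewner order
    (riccati_square), attained at [gain P]; another completed square gives
    [W_H >= S := Q - L' R^-1 L > 0] for every [H] (run_cost_schur). Finally, if
    [E >= 0] and [E v = 0], then [v' (F' E + E F + G' E G) v = (G v)' E (G v)]
    is nonnegative (lyap_kernel). The whole proof rests on these three facts.

    A subsolution yields a solution by policy iteration: freeze the gain of the
    current [P] and solve the linear equation [phi_H E = 0]. The subsolution
    makes this linear operator stable, hence invertible and inverse-positive
    (lyap_solve, lyap_stable), so the iterates decrease and stay positive. Their
    limit solves the equation because gains are bounded on bounded sets of
    nonnegative matrices, which also makes [phi] Lipschitz there.

    For the contraction let [phi Pb = 0], and let [m] be the largest number with
    [m Pb <= S]. If [l <= 1], then [phi_H (l Pb) = l phi_H Pb + (1 - l) W_H] gives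
    [phi (l Pb) >= (1 - l) m Pb], and if [l >= 1] the gain of [Pb] gives
    [phi (l Pb) <= - (l - 1) m Pb]. Hence [e^(-s) Pb] and [e^s Pb] are barriers
    for the flow as soon as [- s' < (1 - e^(-s)) m]: at the first contact of a
    solution [X] with a barrier, a contact vector compares [phi X] with [phi] of
    the barrier, against the sign of the derivative (tube). With
    [s = (1 + e) d e^(-(1 - e) alpha t)] and
    [alpha = m (1 - e^(-d)) / d] the condition on [s] follows from the
    concavity of [1 - e^(-s)]; letting [e] decrease to [0] gives the claimed
    estimate.

    The same barriers with constant [s] confine solutions to an order interval
    around [Pb]. The flow therefore exists globally: extend [phi] from that
    interval to a Lipschitz function on all matrices, solve the extended
    equation by Picard iteration, and observe that the solution never leaves the
    interval. Uniqueness of [Pb] is the contraction applied to a constant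
    flow. *)

(** * Quadratic forms of matrices *)

Definition qf (K : realType) (n : nat) (X : 'M[K]_n) (v : 'cV[K]_n) : K :=
  (v^T *m X *m v) 0 0.

Section Transpose.
Context {K : realType} {m n : nat}.
Implicit Types X Y : 'M[K]_(m, n).

Lemma trmxD X Y : (X + Y)^T = X^T + Y^T. Proof. exact: linearD. Qed.
Lemma trmxN X : (- X)^T = - X^T. Proof. exact: linearN. Qed.
Lemma trmxZ a X : (a *: X)^T = a *: X^T. Proof. exact: linearZ. Qed.
End Transpose.

Section QuadraticForms.
Context {K : realType} {n : nat}.
Implicit Types (X Y E : 'M[K]_n) (v w : 'cV[K]_n).

Lemma symmxP X : reflect (X^T = X) (X \is symmetricmx).
Proof.
apply: (iffP idP) => [/is_hermitianmxP|] XT.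
  by rewrite {2}XT expr0 scale1r map_mx_id.
by apply/is_hermitianmxP; rewrite expr0 scale1r map_mx_id ?XT.
Qed.

Lemma qfE X v : qf X v = \sum_i \sum_j v i 0 * X i j * v j 0.
Proof.
rewrite /qf mxE exchange_big /=; apply: eq_bigr => j _.
by rewrite mxE mulr_suml; apply: eq_bigr => i _; rewrite mxE.
Qed.

Lemma qfD X Y v : qf (X + Y) v = qf X v + qf Y v.
Proof. by rewrite /qf mulmxDr mulmxDl mxE. Qed.

Lemma qfN X v : qf (- X) v = - qf X v.
Proof. by rewrite /qf mulmxN mulNmx mxE. Qed.

Lemma qfB X Y v : qf (X - Y) v = qf X v - qf Y v.
Proof. by rewrite qfD qfN. Qed.

Lemma qfZ a X v : qf (a *: X) v = a * qf X v.
Proof. by rewrite /qf -scalemxAr -scalemxAl mxE. Qed.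

Lemma qf0 v : qf 0 v = 0.
Proof. by rewrite /qf mulmx0 mul0mx mxE. Qed.

Lemma qf0v X : qf X 0 = 0.
Proof. by rewrite /qf mulmx0 mxE. Qed.

Lemma tr00 (M : 'M[K]_1) : M 0 0 = M^T 0 0.
Proof. by rewrite mxE. Qed.

Lemma add00 (M N : 'M[K]_1) : (M + N) 0 0 = M 0 0 + N 0 0.
Proof. by rewrite mxE. Qed.

Lemma zero00 : (0 : 'M[K]_1) 0 0 = 0.
Proof. by rewrite mxE. Qed.

Lemma scale00 a (M : 'M[K]_1) : (a *: M) 0 0 = a * M 0 0.
Proof. by rewrite mxE. Qed.

Lemma qfZv X a v : qf X (a *: v) = a ^+ 2 * qf X v.
Proof. by rewrite /qf trmxZ -!scalemxAl -scalemxAr !mxE mulrA. Qed.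

Lemma qf_add X v w : X \is symmetricmx ->
  qf X (v + w) = qf X v + 2 * (w^T *m X *m v) 0 0 + qf X w.
Proof.
move/symmxP => XT; rewrite /qf trmxD !(mulmxDr, mulmxDl) !add00.
have -> : (v^T *m X *m w) 0 0 = (w^T *m X *m v) 0 0.
  by rewrite [RHS]tr00 !trmx_mul trmxK XT mulmxA.
ring.
Qed.

Lemma qf1_ge0 v : 0 <= qf 1%:M v.
Proof.
by rewrite /qf mulmx1 mxE sumr_ge0// => i _; rewrite mxE -expr2 sqr_ge0.
Qed.

Lemma qf1E v : qf 1%:M v = \sum_i v i 0 ^+ 2.
Proof. by rewrite /qf mulmx1 mxE; apply: eq_bigr => i _; rewrite mxE expr2. Qed.

Lemma qf1_coord v i : v i 0 ^+ 2 <= qf 1%:M v.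
Proof.
by rewrite qf1E (bigD1 i)//= lerDl sumr_ge0// => j _; rewrite sqr_ge0.
Qed.

Lemma qf1_eq0 v : qf 1%:M v = 0 -> v = 0.
Proof.
move=> v0; apply/colP => i; rewrite mxE; apply/eqP.
by rewrite -sqrf_eq0 eq_le sqr_ge0 andbT -v0 qf1_coord.
Qed.

Lemma qf1_gt0 v : v != 0 -> 0 < qf 1%:M v.
Proof.
move=> v0; rewrite lt_neqAle qf1_ge0 eq_sym andbT; apply: contra_neq v0.
exact: qf1_eq0.
Qed.

(** A nonnegative form cannot decrease when an isotropic vector moves, so its
    differential there, which is twice [E v], vanishes. *)
Lemma qf_kernel E v : E \is symmetricmx -> (forall w, 0 <= qf E w) ->
  qf E v = 0 -> E *m v = 0.
Proof.
move=> Es E0 Ev0; apply: qf1_eq0; set w := E *m v.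
have wE : (w^T *m E *m v) 0 0 = qf 1%:M w by rewrite /qf mulmx1 -mulmxA.
have := qf1_ge0 w; rewrite le_eqVlt => /orP[/eqP//|w0].
have H a : 0 <= 2 * a * qf 1%:M w + a ^+ 2 * qf E w.
  have := E0 (v + a *: w); rewrite qf_add// Ev0 add0r qfZv.
  by rewrite trmxZ -!scalemxAl mxE wE mulrA.
have {}E0 := E0 w; set p := qf _ w in w0 H *; set q := qf E w in E0 H *.
(* The form at [v + a w] is [2 a p + a^2 q], negative for this [a]. *)
have := H (- p / (q + 1)).
have q1 : 0 < q + 1 by lra.
have -> : 2 * (- p / (q + 1)) * p + (- p / (q + 1)) ^+ 2 * q =
   - (p / (q + 1)) ^+ 2 * (q + 2) by field; rewrite gt_eqF.
have : 0 < (p / (q + 1)) ^+ 2 by rewrite exprn_gt0// divr_gt0.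
nra.
Qed.

Lemma mx_norm_le (m p : nat) (M : 'M[K]_(m, p)) (c : K) :
  0 <= c -> (forall i j, `|M i j| <= c) -> `|M| <= c.
Proof. by move=> c0 H; rewrite /Num.norm /= mx_normrE bigmax_le// => -[i j] _ /=. Qed.

Lemma mx_entry_le (m p : nat) (M : 'M[K]_(m, p)) i j : `|M i j| <= `|M|.
Proof.
rewrite [leRHS]/Num.norm /= mx_normrE.
exact: (le_bigmax _ (fun ij : 'I_m * 'I_p => `|M ij.1 ij.2|) (i, j)).
Qed.

Lemma qf_norm_le X v : `|qf X v| <= n%:R * `|X| * qf 1%:M v.
Proof.
rewrite qfE; apply: le_trans (ler_norm_sum _ _ _) _.
(* Bound [|v_i v_j|] by [(v_i^2 + v_j^2) / 2]. *)
apply: (@le_trans _ _ (\sum_(i < n) \sum_(j < n)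
    `|X| * ((v i 0 ^+ 2 + v j 0 ^+ 2) / 2))).
  apply: ler_sum => i _; apply: le_trans (ler_norm_sum _ _ _) _.
  apply: ler_sum => j _; rewrite !normrM.
  rewrite mulrAC [leRHS]mulrC ler_pM ?mulr_ge0 ?mx_entry_le//.
  have := sqr_ge0 (`|v i 0| - `|v j 0|).
  rewrite -(real_normK (num_real (v i 0))) -(real_normK (num_real (v j 0))).
  nra.
rewrite le_eqVlt; apply/orP; left; apply/eqP.
under eq_bigr do rewrite -mulr_sumr -mulr_suml big_split /= sumr_const card_ord.
rewrite -mulr_sumr -mulr_suml big_split /= sumr_const card_ord sumrMnl -qf1E.
rewrite -[_ *+ n]mulr_natl; by field.
Qed.

Lemma form_delta X i j :
  ((delta_mx i 0 : 'cV[K]_n)^T *m X *m (delta_mx j 0 : 'cV[K]_n)) 0 0 = X i j.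
Proof. by rewrite trmx_delta -rowE -colE !mxE. Qed.

Lemma polarization X i j : X \is symmetricmx ->
  4 * X i j =
  qf X (delta_mx i 0 + delta_mx j 0) - qf X (delta_mx i 0 - delta_mx j 0).
Proof.
move=> Xs; have Xji : X j i = X i j by rewrite -{1}(symmxP _ Xs) mxE.
rewrite -[- delta_mx j 0]scaleN1r !qf_add// !qfZv trmxZ -!scalemxAl scale00.
by rewrite !form_delta Xji; ring.
Qed.

(** Polarization, then the parallelogram law on two basis vectors, of squared
    norms [1 + 1]. *)
Lemma norm_le_qf X (c : K) : X \is symmetricmx -> 0 <= c ->
  (forall v, `|qf X v| <= c * qf 1%:M v) -> `|X| <= c.
Proof.
move=> Xs c0 H; apply: mx_norm_le => // i j.
have s1 : (1%:M : 'M[K]_n) \is symmetricmx by apply/symmxP; rewrite trmx1.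
pose e (i : 'I_n) : 'cV[K]_n := delta_mx i 0.
have := polarization i j Xs; have := H (e i + e j); have := H (e i - e j).
have q1 k : qf 1%:M (e k) = 1 by rewrite /qf form_delta mxE eqxx.
rewrite -[- e j]scaleN1r !(qf_add _ _ s1) !qfZv trmxZ -!scalemxAl scale00 !q1.
rewrite scaleN1r !ler_norml => /andP[h1 h2] /andP[h3 h4] /= h5.
by apply/andP; split; nra.
Qed.

Lemma qf_inj X Y : X \is symmetricmx -> Y \is symmetricmx ->
  (forall v, qf X v = qf Y v) -> X = Y.
Proof.
move=> Xs Ys XY; apply/eqP; rewrite -subr_eq0 -normr_le0.
apply: norm_le_qf => // [|v]; last by rewrite qfB XY subrr normr0 mul0r.
by apply/symmxP; rewrite trmxD trmxN !(symmxP _ _).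
Qed.

End QuadraticForms.

Lemma qf_conj (K : realType) (n k : nat) (E : 'M[K]_n) (G : 'M[K]_(n, k)) v :
  qf (G^T *m E *m G) v = qf E (G *m v).
Proof. by rewrite /qf trmx_mul !mulmxA. Qed.

(** * Compactness of the unit sphere *)

Lemma continuous_qf (K : realType) (n : nat) (T : topologicalType)
    (X : T -> 'M[K]_n) (v : T -> 'cV[K]_n) (x : T) :
  (forall i j, {for x, continuous (fun t => X t i j)}) ->
  (forall i, {for x, continuous (fun t => v t i 0)}) ->
  {for x, continuous (fun t => qf (X t) (v t))}.
Proof.
move=> Xc vc; rewrite (_ : (fun t => _) =
    fun t => \sum_i \sum_j v t i 0 * X t i j * v t j 0); last first.
  by apply/funext => t; rewrite qfE.
apply: cvg_big => [|i _]; first exact: add_continuous.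
apply: cvg_big => [|j _]; first exact: add_continuous.
by apply: cvgM; [apply: cvgM|]; [exact: vc|exact: Xc|exact: vc].
Qed.

Section Sphere.
Context {K : realType} {n : nat}.

(** Unit vectors are kept as rows, the shape in which bounded closed sets are
    known to be compact. *)
Definition sphere : set 'rV[K]_n := [set u | qf 1%:M u^T = 1].

Lemma continuous_tr_coord (x : 'rV[K]_n) i :
  {for x, continuous (fun u : 'rV[K]_n => u^T i 0)}.
Proof.
rewrite (_ : (fun u => _) = fun u : 'rV[K]_n => u 0 i); last first.
  by apply/funext => u; rewrite mxE.
exact: coord_continuous.
Qed.

Lemma compact_sphere : compact sphere.
Proof.
apply: bounded_closed_compact.
  exists 1; split => // c c1 u u1 /=; apply: mx_norm_le => [|i j]; first lra.
  apply: (@le_trans _ _ 1); last exact: ltW.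
  have := qf1_coord u^T j; rewrite u1 mxE ord1 -real_normK ?num_real// => h.
  by rewrite -(expr_le1 (n := 2))// normr_ge0.
rewrite (_ : sphere = (fun u : 'rV[K]_n => qf 1%:M u^T) @^-1` [set 1])//.
apply: preimage_closed; last exact: closed_eq.
move=> u _; apply: (@continuous_qf K n _ (fun=> 1%:M) (fun u => u^T)) => [i j|i].
  exact: cst_continuous.
exact: continuous_tr_coord.
Qed.

Lemma normalize_sphere (v : 'cV[K]_n) : v != 0 ->
  exists2 u, sphere u & exists2 a, 0 < a & v = a *: u^T.
Proof.
move=> v0; have p := qf1_gt0 v0; have sp : 0 < Num.sqrt (qf 1%:M v) by rewrite sqrtr_gt0.
exists ((Num.sqrt (qf 1%:M v))^-1 *: v)^T; rewrite /sphere /= trmxK.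
  by rewrite qfZv exprVn sqr_sqrtr ?ltW// mulVf// gt_eqF.
by exists (Num.sqrt (qf 1%:M v)) => //; rewrite scalerA divff ?scale1r// gt_eqF.
Qed.

Lemma sphere_neq0 u : sphere u -> u^T != 0.
Proof.
move=> u1; apply/eqP => u0; move: u1; rewrite /sphere /= u0 qf0v => /eqP.
by rewrite eq_sym oner_eq0.
Qed.

(** The generalized Rayleigh quotient attains its minimum on the compact unit
    sphere, hence everywhere by homogeneity. *)
Lemma qf_ratio_min (X Y : 'M[K]_n) (v0 : 'cV[K]_n) : v0 != 0 -> posdefmx Y ->
  exists2 t, (forall v, t * qf Y v <= qf X v) &
    exists2 u, u != 0 & qf X u = t * qf Y u.
Proof.
move=> v00 [_ Y0]; have Yu u : sphere u -> 0 < qf Y u^T.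
  by move=> /sphere_neq0/Y0.
have s0 : sphere !=set0 by have [u ? _] := normalize_sphere v00; exists u.
have qc Z u : {for u, continuous (fun u : 'rV[K]_n => qf Z u^T)}.
  apply: (@continuous_qf K n _ (fun=> Z) (fun u => u^T)) => [i j|i].
    exact: cst_continuous.
  exact: continuous_tr_coord.
have [||u] := @compact_EVT_min _ _ (fun u => qf X u^T / qf Y u^T) sphere s0.
- exact: compact_sphere.
- apply: continuous_in_subspaceT => u; rewrite inE => su.
  apply: (@continuousM _ _ (fun u : 'rV[K]_n => qf X u^T) (fun u => (qf Y u^T)^-1)).
    exact: qc.
  by apply: continuousV; [rewrite gt_eqF ?Yu|exact: qc].
rewrite inE => su umin; exists (qf X u^T / qf Y u^T); last first.
  by exists u^T; [exact: sphere_neq0|rewrite divfK// gt_eqF ?Yu].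
move=> v; have [->|v1] := eqVneq v 0; first by rewrite !qf0v mulr0.
have [w sw [a a0 ->]] := normalize_sphere v1.
rewrite !qfZv mulrCA ler_pM2l ?exprn_gt0// -ler_pdivlMr ?Yu//.
by apply: umin; rewrite inE.
Qed.

Lemma posdef_lower (Y : 'M[K]_n) : posdefmx Y ->
  exists2 c : K, 0 < c & forall v, c * qf 1%:M v <= qf Y v.
Proof.
move=> [Ys Y0]; have [[v0 v00]|triv] := pselect (exists v : 'cV[K]_n, v != 0).
  have p1 : posdefmx (1%:M : 'M[K]_n).
    by split; [apply/symmxP; rewrite trmx1|exact: qf1_gt0].
  have [t tY [u u0 ut]] := qf_ratio_min Y v00 p1.
  by exists t => //; rewrite -(pmulr_lgt0 _ (qf1_gt0 u0)) -ut; exact: Y0.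
exists 1 => // v; have [->|v0] := eqVneq v 0; first by rewrite !qf0v mulr0.
by case: triv; exists v.
Qed.

End Sphere.

(** * Lyapunov operators *)

Definition lyap (K : realType) (n : nat) (F G E : 'M[K]_n) : 'M[K]_n :=
  F^T *m E + E *m F + G^T *m E *m G.

Section Lyapunov.
Context {K : realType} {n : nat}.
Implicit Types (F G E X Y : 'M[K]_n) (v : 'cV[K]_n).

Lemma sym0 : (0 : 'M[K]_n) \is symmetricmx.
Proof. by apply/symmxP; rewrite trmx0. Qed.

Lemma symD X Y : X \is symmetricmx -> Y \is symmetricmx ->
  X + Y \is symmetricmx.
Proof. by move=> /symmxP x /symmxP y; apply/symmxP; rewrite trmxD x y. Qed.

Lemma symN X : X \is symmetricmx -> - X \is symmetricmx.
Proof. by move=> /symmxP x; apply/symmxP; rewrite trmxN x. Qed.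

Lemma symZ a X : X \is symmetricmx -> a *: X \is symmetricmx.
Proof. by move=> /symmxP x; apply/symmxP; rewrite trmxZ x. Qed.

Lemma symB X Y : X \is symmetricmx -> Y \is symmetricmx ->
  X - Y \is symmetricmx.
Proof. by move=> x y; rewrite symD ?symN. Qed.

Lemma posdef_ge0 Y v : posdefmx Y -> 0 <= qf Y v.
Proof.
by move=> [_ Y0]; have [->|/Y0/ltW//] := eqVneq v 0; rewrite qf0v.
Qed.

Lemma posdef_psd Y : posdefmx Y -> psdmx Y.
Proof. by move=> Yp; split=> [|v]; [case: Yp|exact: posdef_ge0]. Qed.

Lemma posdef_unit Y : posdefmx Y -> Y \in unitmx.
Proof.
move=> [_ Y0]; rewrite -row_free_unit -kermx_eq0; apply/rowV0P => v.
move=> /sub_kermxP vY; apply: trmx_inj; rewrite trmx0.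
apply/eqP; apply: contraT => /Y0.
by rewrite trmxK vY mul0mx mxE ltxx.
Qed.

Lemma lyap_sym F G E : E \is symmetricmx -> lyap F G E \is symmetricmx.
Proof.
move/symmxP => ET; apply/symmxP; rewrite /lyap !trmxD !trmx_mul !trmxK ET.
by rewrite mulmxA [_ *m F + _]addrC.
Qed.

Lemma lyapB F G X Y : lyap F G (X - Y) = lyap F G X - lyap F G Y.
Proof.
rewrite /lyap !(mulmxBr, mulmxBl) [X in X + _]addrACA -opprD.
by rewrite addrACA -opprD.
Qed.

Lemma lyapZ F G a X : lyap F G (a *: X) = a *: lyap F G X.
Proof. by rewrite /lyap -!(scalemxAr, scalemxAl) !scalerDr. Qed.

(** On a kernel vector of [E] only the positive term [G^T E G] survives: this
    is what keeps the flow of a Lyapunov operator inside the cone. *)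
Lemma lyap_kernel F G E v : E \is symmetricmx -> (forall w, 0 <= qf E w) ->
  qf E v = 0 -> 0 <= qf (lyap F G E) v.
Proof.
move=> Es E0 /(qf_kernel Es E0) Ev.
have Ev' : v^T *m E = 0 by rewrite -(symmxP _ Es) -trmx_mul Ev trmx0.
rewrite !qfD qf_conj {1}/qf -!mulmxA Ev !mulmx0 mxE add0r.
by rewrite {1}/qf !mulmxA Ev' !mul0mx mxE add0r.
Qed.

(** A nonnegative solution of a Lyapunov equation with positive right-hand
    side is positive, since a kernel vector would violate [lyap_kernel]. *)
Lemma lyap_posdef F G E (W : 'M[K]_n) : psdmx E ->
  (forall v, v != 0 -> 0 < qf W v) ->
  (forall v, qf (lyap F G E) v + qf W v <= 0) -> posdefmx E.
Proof.
move=> [Es E0] W0 EW; split=> // v v0; rewrite lt_neqAle E0 andbT eq_sym.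
apply/eqP => /(lyap_kernel F G Es E0).
by have := EW v; have := W0 _ v0; lra.
Qed.

End Lyapunov.

(** * The Riccati operator as a minimum over feedback gains *)

Lemma complete_square (K : realType) (n k : nat) (M : 'M[K]_k)
    (N H : 'M[K]_(k, n)) : M \is symmetricmx -> M \in unitmx ->
  (H + invmx M *m N)^T *m M *m (H + invmx M *m N) =
  H^T *m M *m H + H^T *m N + N^T *m H + N^T *m invmx M *m N.
Proof.
move=> /symmxP MT Mu; rewrite trmxD trmx_mul trmx_inv MT mulmxDl mulmxKV//.
by rewrite !mulmxDr !mulmxDl !mulmxA mulmxK// addrA [X in X + _]addrAC.
Qed.

Section Riccati.
Context {K : realType} {n k : nat} (A C : 'M[K]_n) (B D : 'M[K]_(n, k))
  (L : 'M[K]_(k, n)) (Q : 'M[K]_n) (R : 'M[K]_k).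
Hypotheses (Qsym : Q \is symmetricmx) (Rsym : R \is symmetricmx)
  (QLRpos : posdefmx (block_mx Q L^T L R)).
Implicit Types (P X Y : 'M[K]_n) (H : 'M[K]_(k, n)) (v : 'cV[K]_n).

Local Notation phi := (riccati A B C D L Q R).

(** The optimal feedback at [P], where the minimum defining the Riccati operator
    is attained. *)
Definition gain P : 'M[K]_(k, n) :=
  - (invmx (R + D^T *m P *m D) *m (B^T *m P + D^T *m P *m C + L)).

(** The quadratic cost of the state [x] under the feedback [x |-> H x]. *)
Definition run_cost H : 'M[K]_n := Q + L^T *m H + H^T *m L + H^T *m R *m H.

(** The minimal running cost, over all feedbacks. *)
Definition schur : 'M[K]_n := Q - L^T *m invmx R *m L.

(** The Lyapunov operator of the system closed by the feedback [x |-> H x]. *)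
Definition clyap H : 'M[K]_n -> 'M[K]_n := lyap (A + B *m H) (C + D *m H).

Lemma clyapB H X Y : clyap H (X - Y) = clyap H X - clyap H Y.
Proof. exact: lyapB. Qed.

Lemma clyapZ H a X : clyap H (a *: X) = a *: clyap H X.
Proof. exact: lyapZ. Qed.

Lemma qf_block v w : qf (block_mx Q L^T L R) (col_mx v w) =
  qf Q v + (v^T *m L^T *m w) 0 0 + (w^T *m L *m v) 0 0 + qf R w.
Proof.
rewrite {1}/qf -mulmxA mul_block_col tr_col_mx mul_row_col !mulmxDr !mulmxA.
by rewrite !add00 !addrA.
Qed.

Lemma R_posdef : posdefmx R.
Proof.
split=> // w w0; have [_ /(_ (col_mx 0 w))] := QLRpos.
rewrite -/(qf _ _) qf_block qf0v mulmx0 trmx0 !mul0mx !zero00 !add0r; apply.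
by apply: contraNneq w0 => /eqP; rewrite col_mx_eq0 => /andP[].
Qed.

Lemma run_cost_gt0 H v : v != 0 -> 0 < qf (run_cost H) v.
Proof.
move=> v0; have [_ /(_ (col_mx v (H *m v)))] := QLRpos.
rewrite -/(qf _ _) qf_block /run_cost !qfD qf_conj /qf trmx_mul !mulmxA.
by apply; rewrite col_mx_eq0 negb_and v0.
Qed.

(** The gap between the two sides is the square of [H + R^-1 L] weighted by
    [R]. *)
Lemma run_cost_schur H v : qf schur v <= qf (run_cost H) v.
Proof.
have /(@complete_square _ _ _ _ L H Rsym) e := posdef_unit R_posdef.
have : 0 <= qf R ((H + invmx R *m L) *m v) by exact: posdef_ge0 R_posdef.
by rewrite -qf_conj e /run_cost /schur !(qfD, qfN); lra.
Qed.

Lemma run_cost_sym H : run_cost H \is symmetricmx.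
Proof.
apply/symmxP; rewrite /run_cost !trmxD !trmx_mul !trmxK (symmxP _ Qsym).
by rewrite (symmxP _ Rsym) mulmxA (addrAC Q).
Qed.

(** The Schur complement is the running cost of the gain [- R^-1 L]. *)
Lemma schur_gt0 v : v != 0 -> 0 < qf schur v.
Proof.
move=> /(run_cost_gt0 (- (invmx R *m L))); congr (0 < _).
have := complete_square L (- (invmx R *m L)) Rsym (posdef_unit R_posdef).
rewrite addNr mulmx0 => /(congr1 (fun X => qf X v)).
by rewrite qf0 /run_cost /schur !(qfD, qfN); lra.
Qed.

Lemma schur_sym : schur \is symmetricmx.
Proof.
by apply/symmxP; rewrite trmxD trmxN !trmx_mul trmxK trmx_inv !(symmxP _ _)// mulmxA.
Qed.

Lemma schur_posdef : posdefmx schur.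
Proof. by split; [exact: schur_sym|exact: schur_gt0]. Qed.

Lemma weight_posdef P : psdmx P -> posdefmx (R + D^T *m P *m D).
Proof.
move=> [Ps P0]; split.
  apply: symD => //; apply/symmxP.
  by rewrite !trmx_mul trmxK (symmxP _ Ps) mulmxA.
move=> v v0; rewrite -/(qf _ _) qfD qf_conj ltr_pwDl//; last exact: P0.
by case: R_posdef => _; apply.
Qed.

(** The completed square in the gain: the Riccati operator is the minimum over
    [H] of the affine operators [P |-> clyap H P + run_cost H]. *)
Lemma riccati_square P H v : psdmx P ->
  qf (clyap H P) v + qf (run_cost H) v =
  qf (phi P) v + qf (R + D^T *m P *m D) ((H - gain P) *m v).
Proof.
move=> Pp; have Mp := weight_posdef Pp; have [Ps _] := Pp.
rewrite -qf_conj /gain opprK complete_square//; first last.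
- exact: posdef_unit.
- by case: Mp.
rewrite /riccati; set N := _ + L; set T := N^T *m _ *m N.
rewrite -mulmxA -/T qfD.
rewrite /N /clyap /lyap /run_cost.
rewrite !(trmxD, trmx_mul, trmxK, mulmxDl, mulmxDr) (symmxP _ Ps) !mulmxA.
rewrite !(qfD, qfN); lra.
Qed.

Lemma riccati_le P H v : psdmx P ->
  qf (phi P) v <= qf (clyap H P) v + qf (run_cost H) v.
Proof.
by move=> Pp; rewrite riccati_square// lerDl; exact/posdef_ge0/weight_posdef.
Qed.

Lemma riccati_gain P v : psdmx P ->
  qf (phi P) v = qf (clyap (gain P) P) v + qf (run_cost (gain P)) v.
Proof. by move=> Pp; rewrite riccati_square// subrr mul0mx qf0v addr0. Qed.

Lemma riccati_sym P : psdmx P -> phi P \is symmetricmx.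
Proof.
move=> Pp; have [Ms _] := weight_posdef Pp; have [Ps _] := Pp.
rewrite /riccati; set N := _ + L; set M := R + _.
apply/symmxP; rewrite !(trmxD, trmxN, trmx_mul, trmxK) trmx_inv.
by rewrite (symmxP _ Qsym) (symmxP _ Ps) (symmxP _ Ms) !mulmxA [P *m A + _]addrC.
Qed.

End Riccati.

(** * Bounds on gains and the Lipschitz property *)

Section MatrixNorm.
Context {K : realType}.

Lemma mx_norm_mul (m n p : nat) (M : 'M[K]_(m, n)) (N : 'M[K]_(n, p)) :
  `|M *m N| <= n%:R * (`|M| * `|N|).
Proof.
apply: mx_norm_le => [|i j]; first by rewrite !mulr_ge0.
rewrite mxE; apply: le_trans (ler_norm_sum _ _ _) _.
apply: (@le_trans _ _ (\sum_(l < n) `|M| * `|N|)).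
  by apply: ler_sum => l _; rewrite normrM ler_pM ?mx_entry_le.
by rewrite sumr_const card_ord mulr_natl.
Qed.

Lemma mx_norm_tr (m n : nat) (M : 'M[K]_(m, n)) : `|M^T| <= `|M|.
Proof. by apply: mx_norm_le => // i j; rewrite mxE mx_entry_le. Qed.

Lemma lyap_norm (n : nat) (F G E : 'M[K]_n) :
  `|lyap F G E| <= (2 * n%:R * `|F| + n%:R ^+ 2 * `|G| ^+ 2) * `|E|.
Proof.
have FE : `|F^T *m E| <= n%:R * (`|F| * `|E|).
  apply: le_trans (mx_norm_mul _ _) _.
  by rewrite ler_wpM2l// ler_wpM2r// mx_norm_tr.
have GE : `|G^T *m E *m G| <= n%:R * ((n%:R * (`|G| * `|E|)) * `|G|).
  apply: le_trans (mx_norm_mul _ _) _.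
  rewrite ler_wpM2l// ler_wpM2r//; apply: le_trans (mx_norm_mul _ _) _.
  by rewrite ler_wpM2l// ler_wpM2r// mx_norm_tr.
apply: le_trans (ler_normD _ _) _.
apply: le_trans (lerD (ler_normD _ _) GE) _.
have := mx_norm_mul E F.
by move: FE; rewrite -!mulrA; nra.
Qed.

End MatrixNorm.

Section GainBound.
Context {K : realType} {n k : nat} (A C : 'M[K]_n) (B D : 'M[K]_(n, k))
  (L : 'M[K]_(k, n)) (Q : 'M[K]_n) (R : 'M[K]_k).
Hypotheses (Qsym : Q \is symmetricmx) (Rsym : R \is symmetricmx)
  (QLRpos : posdefmx (block_mx Q L^T L R)).
Implicit Types (P X Y : 'M[K]_n).

Local Notation phi := (riccati A B C D L Q R).
Local Notation gain := (gain C B D L R).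
Local Notation clyap := (clyap A C B D).

(** The gain solves [M u = - N v] with [M >= R >= r], so that
    [r |u| <= |N v|], whatever the size of [M]. *)
Lemma gain_bounded (b : K) : exists2 c : K, 0 <= c &
  forall P, psdmx P -> `|P| <= b -> `|gain P| <= c.
Proof.
have [r r0 Rr] := posdef_lower (R_posdef Rsym QLRpos).
have [b0|b0] := leP 0 b; last first.
  by exists 0 => // P _ /(le_trans (normr_ge0 _)); rewrite leNgt b0.
pose c := n%:R * (`|B^T| * b) + n%:R * (n%:R * (`|D^T| * b) * `|C|) + `|L|.
have c0 : 0 <= c by rewrite /c !addr_ge0 ?mulr_ge0.
exists (k.+1%:R * c / r) => [|P Pp Pb]; first by rewrite divr_ge0 ?mulr_ge0// ltW.
apply: mx_norm_le => [|i j]; first by rewrite divr_ge0 ?mulr_ge0// ltW.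
have Mp := weight_posdef D Rsym QLRpos Pp; have [Ps P0] := Pp.
have MR v : r * qf 1%:M v <= qf (R + D^T *m P *m D) v.
  by apply: le_trans (Rr v) _; rewrite qfD qf_conj lerDl; exact: P0.
rewrite /gain; set N := _ + L; set M := R + _ in Mp MR *.
have Nc : `|N| <= c.
  apply: le_trans (ler_normD _ _) _; rewrite lerD2r.
  apply: le_trans (ler_normD _ _) _; apply: lerD.
    apply: le_trans (mx_norm_mul _ _) _.
    by rewrite ler_wpM2l// ler_wpM2l.
  apply: le_trans (mx_norm_mul _ _) _.
  rewrite ler_wpM2l// ler_wpM2r//; apply: le_trans (mx_norm_mul _ _) _.
  by rewrite ler_wpM2l// ler_wpM2l.
pose e : 'cV[K]_n := delta_mx j 0.
pose w := N *m e; pose u := - (invmx M *m N) *m e.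
have wu : w = - (M *m u).
  by rewrite /u mulNmx mulmxN opprK -mulmxA mulKVmx// posdef_unit.
have s1 : (1%:M : 'M[K]_k) \is symmetricmx by apply/symmxP; rewrite trmx1.
(* With [w = - M u], expanding [0 <= |w + r u|^2] and using
   [u' M u >= r |u|^2] leaves [r^2 |u|^2 <= |w|^2]. *)
have := qf1_ge0 (w + r *: u); rewrite qf_add// qfZv trmxZ -!scalemxAl scale00.
have -> : (u^T *m 1%:M *m w) 0 0 = - qf M u.
  by rewrite mulmx1 wu mulmxN mxE /qf mulmxA.
have wc : qf 1%:M w <= k%:R * c ^+ 2.
  rewrite qf1E; apply: (@le_trans _ _ (\sum_(l < k) c ^+ 2)); last first.
    by rewrite sumr_const card_ord mulr_natl.
  apply: ler_sum => l _; rewrite /w -colE mxE -real_normK ?num_real//.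
  by rewrite ler_sqr ?nnegrE// (le_trans (mx_entry_le _ _ _)).
have := MR u; have := qf1_coord u i.
have -> : u i 0 = (- (invmx M *m N)) i j by rewrite /u -colE mxE.
set x := fun_of_matrix _ i j; set q := qf 1%:M u; move=> xq rq h.
rewrite -ler_pdivrMr ?invr_gt0// invrK -(gtr0_norm r0) -normrM.
rewrite -(@ler_sqr _ _ (k.+1%:R * c)) ?nnegrE ?mulr_ge0//.
rewrite real_normK ?num_real// exprMn.
have {}h : r ^+ 2 * q <= k%:R * c ^+ 2 by move: h wc rq; nra.
have : r ^+ 2 * x ^+ 2 <= r ^+ 2 * q by rewrite ler_wpM2l// sqr_ge0.
have := sqr_ge0 c; rewrite -natr1; have : 0 <= (k%:R : K) by [].
by move: h; nra.
Qed.

Lemma clyap_gain_bounded (b : K) : exists2 c : K, 0 <= c &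
  forall P E, psdmx P -> `|P| <= b -> `|clyap (gain P) E| <= c * `|E|.
Proof.
have [c c0 gb] := gain_bounded b.
pose f := `|A| + k%:R * (`|B| * c); pose g := `|C| + k%:R * (`|D| * c).
have f0 : 0 <= f by rewrite addr_ge0 ?mulr_ge0.
have g0 : 0 <= g by rewrite addr_ge0 ?mulr_ge0.
exists (2 * n%:R * f + n%:R ^+ 2 * g ^+ 2).
  by rewrite addr_ge0 ?mulr_ge0 ?exprn_ge0.
move=> P E Pp Pb; apply: le_trans (lyap_norm _ _ _) _; rewrite ler_wpM2r//.
have bd (U : 'M[K]_n) (V : 'M[K]_(n, k)) :
    `|U + V *m gain P| <= `|U| + k%:R * (`|V| * c).
  apply: le_trans (ler_normD _ _) _; rewrite lerD2l.
  by apply: le_trans (mx_norm_mul _ _) _; rewrite !ler_wpM2l// gb.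
apply: lerD; first by rewrite ler_wpM2l// bd.
by rewrite ler_wpM2l// ?exprn_ge0// ler_sqr ?nnegrE// bd.
Qed.

(** By minimality of the gains,
    [clyap (gain X) (X - Y) <= phi X - phi Y <= clyap (gain Y) (X - Y)]. *)
Lemma riccati_lipschitz (b : K) : exists2 c : K, 0 <= c &
  forall X Y, psdmx X -> psdmx Y -> `|X| <= b -> `|Y| <= b ->
    `|phi X - phi Y| <= c * `|X - Y|.
Proof.
have [c c0 H] := clyap_gain_bounded b.
exists (n%:R * c) => [|X Y Xp Yp Xb Yb]; first by rewrite mulr_ge0.
apply: norm_le_qf => [||v]; [|by rewrite !mulr_ge0|].
  by apply: symB; apply: riccati_sym.
have up U V : psdmx U -> psdmx V -> `|V| <= b -> `|U - V| = `|X - Y| ->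
    qf (phi U) v - qf (phi V) v <= n%:R * c * `|X - Y| * qf 1%:M v.
  move=> Up Vp Vb UV.
  have := riccati_le A C B D Rsym QLRpos (gain V) v Up.
  have := riccati_gain A C B D Rsym QLRpos v Vp.
  have := qf_norm_le (clyap (gain V) (U - V)) v.
  rewrite clyapB qfB ler_norml => /andP[_ h] hV hU.
  have {h} : qf (clyap (gain V) U) v - qf (clyap (gain V) V) v <=
      n%:R * c * `|X - Y| * qf 1%:M v.
    apply: le_trans h _; rewrite ler_wpM2r ?qf1_ge0// -mulrA ler_wpM2l//.
    by rewrite -clyapB -UV H.
  by lra.
by rewrite ler_norml qfB lerNl opprB !up// distrC.
Qed.

End GainBound.

(** * Lyapunov equations and policy iteration *)

Section LyapunovEquation.
Context {K : realType} {n : nat} (F G P0 : 'M[K]_n).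
Hypotheses (P0pos : posdefmx P0)
  (P0stable : forall v, v != 0 -> qf (lyap F G P0) v < 0).
Implicit Types (E W : 'M[K]_n).

(** If the least [t] with [t P0 <= E] were negative, a contact vector of
    [E - t P0 >= 0] would contradict [lyap_kernel]. *)
Lemma lyap_stable E : E \is symmetricmx -> (forall v, qf (lyap F G E) v <= 0) ->
  forall v, 0 <= qf E v.
Proof.
move=> Es E0 v; have [->|v0] := eqVneq v 0; first by rewrite qf0v.
have [t tE [u u0 ut]] := qf_ratio_min E v0 P0pos.
apply: le_trans (tE v); rewrite mulr_ge0 ?posdef_ge0//.
rewrite leNgt; apply/negP => t0.
have : 0 <= qf (lyap F G (E - t *: P0)) u.
  apply: lyap_kernel => [|w|].
  - by case: P0pos => Ps _; rewrite symB ?symZ.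
  - by rewrite qfB qfZ subr_ge0.
  - by rewrite qfB qfZ ut subrr.
rewrite lyapB lyapZ qfB qfZ; have := E0 u; have := P0stable u0; nra.
Qed.

Lemma lyap_inj E : E \is symmetricmx -> lyap F G E = 0 -> E = 0.
Proof.
move=> Es E0; apply: qf_inj => // [|v]; first exact: sym0.
rewrite qf0; apply/eqP; rewrite eq_le lyap_stable// ?andbT; last first.
  by move=> w; rewrite E0 qf0.
rewrite -oppr_ge0 -qfN lyap_stable ?symN// => w.
by rewrite -[- E]add0r lyapB E0 qfB qf0 subr0 /lyap !(mulmx0, mul0mx) !addr0 qf0.
Qed.

(** Injectivity is only known on symmetric matrices, so the operator is
    completed by the skew part before inverting it on all matrices. *)
Lemma lyap_solve W : W \is symmetricmx ->
  exists2 E, E \is symmetricmx & lyap F G E = W.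
Proof.
move=> Ws; pose T E := lyap F G (E + E^T) + (E - E^T).
have lT : linear T.
  move=> a X Y; rewrite /T trmxD trmxZ.
  have -> : a *: X + Y + (a *: X^T + Y^T) = a *: (X + X^T) - (- (Y + Y^T)).
    by rewrite opprK scalerDr addrACA.
  have lN Z : lyap F G (- Z) = - lyap F G Z.
    by rewrite -scaleN1r lyapZ scaleN1r.
  rewrite lyapB lN opprK lyapZ.
  move: (lyap _ _ _) (lyap _ _ _) => l l'.
  rewrite scalerDr scalerBr [RHS]addrACA; congr (_ + _).
  by rewrite opprD addrACA.
pose T' : {linear 'M[K]_n -> 'M[K]_n} :=
  HB.pack T (GRing.isLinear.Build _ _ _ _ T lT).
have TE E : T' E = lyap F G (E + E^T) + (E - E^T) by [].
have sE E : E + E^T \is symmetricmx by apply/symmxP; rewrite trmxD trmxK addrC.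
have split E Z : Z \is symmetricmx -> T' E = Z ->
    E^T = E /\ lyap F G (E + E^T) = Z.
  move=> /symmxP Zs; rewrite TE => EZ.
  have ET : E^T = E.
    apply/matrixP => i j; have := congr1 (fun M => M^T i j) EZ.
    rewrite Zs -{1}EZ trmxD (symmxP _ (lyap_sym F G (sE E))) trmxD trmxN trmxK.
    by move: (lyap _ _ _) => l; rewrite !mxE; lra.
  by split=> //; move: EZ; rewrite {2}ET subrr addr0.
have Mu : lin_mx T' \in unitmx.
  rewrite -row_free_unit -kermx_eq0; apply/rowV0P => u /sub_kermxP uM.
  have := mul_vec_lin T' (vec_mx u); rewrite vec_mxK uM => /(canLR mxvecK).
  rewrite linear0 => /esym/(split _ _ sym0)[ET].
  move=> /(lyap_inj (sE _)); rewrite ET => E0.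
  rewrite -[u]vec_mxK; have -> : vec_mx u = 0; last by rewrite linear0.
  move: (vec_mx u) E0 => U E0; apply/matrixP => i j.
  by have := congr1 (fun M : 'M[K]_n => M i j) E0; rewrite !mxE; lra.
have := mul_vec_lin T' (vec_mx (mxvec W *m invmx (lin_mx T'))).
rewrite vec_mxK mulmxKV// => /(can_inj mxvecK)/esym/(split _ _ Ws)[_ EW].
by eexists; last exact: EW.
Qed.

End LyapunovEquation.

(** A decreasing sequence of nonnegative forms converges: each [qf (P j) v]
    does, and polarization recovers the entries. *)
Lemma psd_decreasing_cvg (K : realType) (n : nat) (P : nat -> 'M[K]_n) :
  (forall j, psdmx (P j)) -> (forall j v, qf (P j.+1) v <= qf (P j) v) ->
  exists2 Pb, psdmx Pb &
    forall e : K, 0 < e -> \forall j \near \oo, `|Pb - P j| <= e.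
Proof.
move=> Pp Pd.
have cq v : cvgn (fun j => qf (P j) v).
  apply: nonincreasing_is_cvgn; first exact/nonincreasing_seqP.
  by exists 0 => _ [j _ <-]; case: (Pp j) => _; exact.
have cP a b : cvgn (fun j => P j a b).
  rewrite (_ : (fun j => _) = fun j => 4^-1 *
      (qf (P j) (delta_mx a 0 + delta_mx b 0) -
       qf (P j) (delta_mx a 0 - delta_mx b 0))).
    by apply: is_cvgMr; apply: is_cvgB; exact: cq.
  by apply/funext => j; rewrite -polarization ?mulKf//; case: (Pp j).
pose Pb := \matrix_(a < n, b < n) limn (fun j => P j a b).
have Plim e : 0 < e -> \forall j \near \oo, `|Pb - P j| <= e.
  move=> e0; have : \forall j \near \oo, forall a b, `|Pb a b - P j a b| <= e.
    apply: filter_forall => a; apply: filter_forall => b.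
    by rewrite mxE; have /cvgrPdist_le := cP a b; apply.
  apply: filterS => j h; apply: mx_norm_le => [|a b]; first exact: ltW.
  by rewrite !mxE; have := h a b; rewrite mxE.
exists Pb => //; split.
  apply/symmxP/matrixP => a b; rewrite !mxE; congr (limn _); apply/funext => j.
  by case: (Pp j) => /symmxP Ps _; rewrite -{1}Ps mxE.
move=> v; rewrite -/(qf _ _); apply/ler_addgt0Pl => e e0.
pose c := n%:R * qf 1%:M v; have c0 : 0 <= c by rewrite mulr_ge0 ?qf1_ge0.
have /Plim[j _ /(_ j (leqnn j)) Pj] : 0 < e / (c + 1) by rewrite divr_gt0//; lra.
have := qf_norm_le (Pb - P j) v; rewrite qfB ler_norml => /andP[h _].
have [_ /(_ v)] := Pp j; rewrite -/(qf _ _).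
have : n%:R * `|Pb - P j| * qf 1%:M v <= e.
  rewrite mulrAC -/c; apply: (@le_trans _ _ (c * (e / (c + 1)))).
    by rewrite ler_wpM2l.
  by rewrite mulrA ler_pdivrMr; nra.
by lra.
Qed.

Section PolicyIteration.
Context {K : realType} {n k : nat} (A C : 'M[K]_n) (B D : 'M[K]_(n, k))
  (L : 'M[K]_(k, n)) (Q : 'M[K]_n) (R : 'M[K]_k).
Hypotheses (Qsym : Q \is symmetricmx) (Rsym : R \is symmetricmx)
  (QLRpos : posdefmx (block_mx Q L^T L R)).
Implicit Types (P E X Y : 'M[K]_n).

Local Notation phi := (riccati A B C D L Q R).
Local Notation gain := (gain C B D L R).
Local Notation clyap := (clyap A C B D).
Local Notation run_cost := (run_cost L Q R).

(** One step of policy iteration: keep the gain of [P] and solve the resulting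
    linear equation. *)
Lemma policy_step P : posdefmx P -> (forall v, qf (phi P) v <= 0) ->
  exists E, [/\ posdefmx E, forall v, qf (phi E) v <= 0,
    forall v, qf E v <= qf P v &
    forall v, qf (phi P) v = qf (clyap (gain P) (P - E)) v].
Proof.
move=> Pp phiP; have Ppsd := posdef_psd Pp; pose H := gain P.
have phiE := riccati_gain A C B D Rsym QLRpos _ Ppsd.
have W0 := run_cost_gt0 QLRpos H.
have stab v : v != 0 -> qf (clyap H P) v < 0.
  by move=> v0; have := phiP v; rewrite phiE; have := W0 _ v0; lra.
have Wsym : - run_cost H \is symmetricmx.
  by apply: symN; apply: run_cost_sym.
have [E Es EW] := lyap_solve Pp stab Wsym.
have EWv v : qf (clyap H E) v + qf (run_cost H) v = 0.
  by rewrite /clyap EW qfN addNr.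
have Epsd : psdmx E.
  split=> // v; apply: (lyap_stable Pp stab) => // w.
  have := EWv w; rewrite /clyap; have [->|/W0] := eqVneq w 0; last lra.
  by rewrite !qf0v.
have PE v : qf (phi P) v = qf (clyap H (P - E)) v.
  by rewrite phiE clyapB qfB; have := EWv v; rewrite /H; lra.
exists E; split=> //.
- apply: (@lyap_posdef _ _ (A + B *m H) (C + D *m H) E _ Epsd W0) => v.
  by move: (EWv v) => /eqP; rewrite eq_le => /andP[].
- by move=> v; rewrite -(EWv v); apply: riccati_le Epsd.
- move=> v; rewrite -subr_ge0 -qfB; apply: (lyap_stable Pp stab).
    by apply: symB => //; case: Pp.
  by move=> w; have := phiP w; rewrite PE.
Qed.

(** Along policy iteration [phi (P j)] equals the Lyapunov operator of a bounded
    gain applied to [P j - P j.+1], which tends to zero; continuity of [phi]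
    then makes the limit a solution. *)
Theorem riccati_solvable P0 : posdefmx P0 -> (forall v, qf (phi P0) v <= 0) ->
  exists2 P, posdefmx P & phi P = 0.
Proof.
move=> P0pos P0sub.
pose good P := posdefmx P /\ forall v, qf (phi P) v <= 0.
pose next (P E : {P | good P}) := (forall v, qf (sval E) v <= qf (sval P) v) /\
  forall v, qf (phi (sval P)) v = qf (clyap (gain (sval P)) (sval P - sval E)) v.
have step (P : {P | good P}) : {E | next P E}.
  apply: cid; case: P => P [Pp Psub].
  have [E [Ep Esub EP PE]] := policy_step Pp Psub.
  by exists (exist _ E (conj Ep Esub)).
have [f [f0 fS]] := dependent_choice step (exist good P0 (conj P0pos P0sub)).
pose P j := sval (f j).
have Ppos j : posdefmx (P j) by case: (svalP (f j)).
have Ppsd j : psdmx (P j) by exact: posdef_psd.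
have Psub j v : qf (phi (P j)) v <= 0 by case: (svalP (f j)).
have Pd j v : qf (P j.+1) v <= qf (P j) v by case: (fS j).
have [Pb Pbpsd Plim] := psd_decreasing_cvg Ppsd Pd.
pose b := n%:R * `|P0| + `|Pb|.
have Pb_b : `|Pb| <= b by rewrite lerDr mulr_ge0.
have P_b j : `|P j| <= b.
  apply: (@le_trans _ _ (n%:R * `|P0|)); last by rewrite lerDl.
  apply: norm_le_qf => [||v]; [by case: (Ppos j)|by rewrite mulr_ge0|].
  rewrite ger0_norm ?posdef_ge0//; apply: le_trans (qf_norm_le P0 v).
  apply: le_trans (ler_norm _); elim: j => [|j]; first by rewrite /P f0.
  exact: le_trans.
have [c c0 Hlip] := riccati_lipschitz A C B D Qsym Rsym QLRpos b.
have [d d0 Hgain] := clyap_gain_bounded A C B D Rsym QLRpos b.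
have phiPb : phi Pb = 0.
  apply/eqP; rewrite -normr_le0; apply/ler_addgt0Pl => e e0; rewrite addr0.
  pose m := c + 2 * n%:R * d + 1.
  have m0 : 0 < m by rewrite /m ltr_wpDl// addr_ge0// !mulr_ge0.
  have [N _ PN] := Plim (e / m) (divr_gt0 e0 m0).
  have h1 := PN N (leqnn N); have h2 := PN N.+1 (leqW (leqnn N)).
  have h3 : `|phi (P N)| <= n%:R * (d * (2 * (e / m))).
    apply: norm_le_qf => [||v].
    - by apply: riccati_sym.
    - by have /ltW := divr_gt0 e0 m0; move=> ?; do 3!rewrite mulr_ge0//.
    have [_ ->] := fS N; apply: le_trans (qf_norm_le _ _) _.
    rewrite ler_wpM2r ?qf1_ge0// ler_wpM2l//.
    apply: le_trans (Hgain _ _ (Ppsd N) (P_b N)) _; rewrite ler_wpM2l//.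
    rewrite (_ : _ - _ = Pb - P N.+1 - (Pb - P N)); last first.
      by rewrite opprB [RHS]addrC addrA subrK.
    by apply: le_trans (ler_normB _ _) _; lra.
  have h4 := Hlip _ _ Pbpsd (Ppsd N) Pb_b (P_b N).
  rewrite -[phi Pb](subrK (phi (P N))); apply: le_trans (ler_normD _ _) _.
  apply: le_trans (lerD h4 h3) _.
  apply: (@le_trans _ _ (m * (e / m))); last by rewrite mulrC divfK// gt_eqF.
  have : 0 < e / m by rewrite divr_gt0.
  by rewrite /m; nra.
exists Pb => //.
apply: (@lyap_posdef _ _ (A + B *m gain Pb) (C + D *m gain Pb) _ _ Pbpsd
    (run_cost_gt0 QLRpos (gain Pb))) => v.
have := riccati_gain A C B D Rsym QLRpos v Pbpsd.
by rewrite phiPb qf0 => /esym/eqP; rewrite eq_le => /andP[].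
Qed.

End PolicyIteration.

(** * Global solutions of Lipschitz matrix equations *)

(** McShane's extension: the largest [c]-Lipschitz function below the cones
    [x |-> f y + c |x - y|] agrees with [f] on [J]. *)
Lemma lipschitz_extension (K : realType) (V : normedModType K) (J : set V)
    (f : V -> K) (c : K) : 0 <= c -> J !=set0 ->
  (forall x y, J x -> J y -> `|f x - f y| <= c * `|x - y|) ->
  let g x := inf [set f y + c * `|x - y| | y in J] in
  (forall x, J x -> g x = f x) /\ forall x y, `|g x - g y| <= c * `|x - y|.
Proof.
move=> c0 [z Jz] flip g.
have lb x y : J y -> f z - c * `|x - z| <= f y + c * `|x - y|.
  move=> Jy; have := flip _ _ Jz Jy; rewrite ler_norml => /andP[_].
  have : c * `|z - y| <= c * (`|x - z| + `|x - y|).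
    by rewrite ler_wpM2l// (distrC x z) ler_distD.
  lra.
have hi x : has_inf [set f y + c * `|x - y| | y in J].
  split; first by exists (f z + c * `|x - z|), z.
  by exists (f z - c * `|x - z|) => _ [y Jy <-]; exact: lb.
have up x y : g x <= g y + c * `|x - y|.
  rewrite -lerBlDr; apply: lb_le_inf; first by case: (hi y).
  move=> _ [w Jw <-]; rewrite lerBlDr.
  apply: (@le_trans _ _ (f w + c * `|x - w|)).
    by apply: ge_inf; [case: (hi x)|exists w].
  rewrite -addrA lerD2l -mulrDr ler_wpM2l// [leRHS]addrC.
  exact: ler_distD.
split=> [x Jx|x y].
  apply/eqP; rewrite eq_le; apply/andP; split.
    apply: ge_inf; first by case: (hi x).
    by exists x => //; rewrite subrr normr0 mulr0 addr0.
  apply: lb_le_inf; first by case: (hi x).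
  move=> _ [y Jy <-]; have := flip _ _ Jx Jy; rewrite ler_norml => /andP[_].
  lra.
have := up x y; have := up y x; rewrite (distrC y x) => h1 h2.
by rewrite ler_norml; apply/andP; split; lra.
Qed.

(** The lower bounds [u j - 2 a 2^-j] increase and stay below the decreasing
    upper bounds [u j + 2 a 2^-j], so their supremum is the limit. *)
Lemma geometric_limit (K : realType) (u : nat -> K) (a : K) : 0 <= a ->
  (forall j, `|u j.+1 - u j| <= a * 2 ^- j) ->
  exists l, forall j, `|l - u j| <= 2 * a * 2 ^- j.
Proof.
move=> a0 ua; pose d j : K := 2 * a * 2 ^- j.
have dS j : d j = d j.+1 + a * 2 ^- j.
  by rewrite /d exprS invfM; field.
have d0 j : 0 <= d j by rewrite !mulr_ge0// invr_ge0 exprn_ge0.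
have lo i j : (i <= j)%N -> u i - d i <= u j - d j.
  elim: j => [|j IH]; first by rewrite leqn0 => /eqP ->.
  rewrite leq_eqVlt => /orP[/eqP -> //|/IH /le_trans]; apply.
  by have := ua j; rewrite ler_norml (dS j) => /andP[]; lra.
have hi i j : (i <= j)%N -> u j + d j <= u i + d i.
  elim: j => [|j IH]; first by rewrite leqn0 => /eqP ->.
  rewrite leq_eqVlt => /orP[/eqP -> //|/IH]; apply: le_trans.
  by have := ua j; rewrite ler_norml (dS j) => /andP[]; lra.
pose A := [set u i - d i | i in [set: nat]].
have Aub j : ubound A (u j + d j).
  move=> _ [i _ <-]; have := lo i _ (leq_maxl i j).
  by have := hi j _ (leq_maxr i j); have := d0 (maxn i j); lra.
exists (sup A) => j; rewrite ler_norml; apply/andP; split.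
  have : u j - d j <= sup A by apply: ub_le_sup; [exists (u j + d j)|exists j].
  by rewrite /d; lra.
have : sup A <= u j + d j by apply: sup_le_ub => //; exists (u 0 - d 0), 0%N.
by rewrite /d; lra.
Qed.

Section Derivatives.
Context {K : realType}.

Lemma is_derive_mxP (m n : nat) (X : K -> 'M[K]_(m, n)) t dX :
  is_derive t (1 : K) X dX <->
  forall i j, is_derive t (1 : K) (fun s => X s i j) (dX i j).
Proof.
split=> [[Xd <-] i j|H].
  have /derivable_mxP Xdij := Xd.
  by apply: DeriveDef => //; rewrite derive_mx// mxE.
have Xd : derivable X t 1 by apply/derivable_mxP => i j; case: (H i j).
apply: DeriveDef => //; rewrite derive_mx//; apply/matrixP => i j.
by rewrite mxE; case: (H i j).
Qed.

Lemma continuous_mxP (T : topologicalType) (m n : nat) (X : T -> 'M[K]_(m, n)) t :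
  {for t, continuous X} <-> forall i j, {for t, continuous (fun s => X s i j)}.
Proof.
split=> [Xc i j|H].
  apply: (continuous_comp (f := X) (g := fun M : 'M[K]_(m, n) => M i j)) => //.
  exact: coord_continuous.
apply/cvgrPdist_le => e e0.
have : \forall s \near t, forall i j, `|X t i j - X s i j| <= e.
  apply: filter_forall => i; apply: filter_forall => j.
  by have /cvgrPdist_le := H i j; apply.
apply: filterS => s h; apply: mx_norm_le => [|i j]; first exact: ltW.
by rewrite !mxE.
Qed.

(** The integral starts at [-1], so that the derivative at [0] is two-sided. *)
Lemma antiderivative (h : K -> K) : continuous h ->
  exists2 G : K -> K, G 0 = 0 & forall t : K, -1 < t -> is_derive t (1 : K) G (h t).
Proof.
move=> hc; pose G t := (\int[@lebesgue_measure K]_(x in [set` `[-1, t]]) h x)%R.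
exists (G - cst (G 0)); first by rewrite fctE subrr.
move=> t t1; rewrite -[h t]subr0; apply: is_deriveB.
have tt : t < t + 1 by lra.
have int : (@lebesgue_measure K).-integrable `[-1, t + 1] (EFin \o h).
  apply: continuous_compact_integrable; first exact: segment_compact.
  exact: continuous_subspaceT.
have [Gd GE] := continuous_FTC1_closed tt int t1 (hc t).
by apply: DeriveDef => //; rewrite -derive1E.
Qed.

(** Comparison of [g] with [c e^(bt)], whose derivative dominates that of [g]. *)
Lemma exp_growth (g dg : K -> K) (b c : K) : 0 <= c -> 0 < b ->
  continuous g -> g 0 = 0 -> (forall t : K, 0 < t -> is_derive t (1 : K) g (dg t)) ->
  (forall t : K, 0 <= t -> `|dg t| <= c * b * expR (b * t)) ->
  forall t : K, 0 <= t -> `|g t| <= c * expR (b * t).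
Proof.
move=> c0 b0 gc g0 gd gb t t0.
have de s : is_derive s (1 : K) (fun s => c * expR (b * s)) (c * b * expR (b * s)).
  have db : is_derive s (1 : K) (fun s => b * s) b.
    have := is_deriveZ b (is_derive_id s (1 : K)).
    by rewrite /GRing.scale /= mulr1.
  have := is_deriveZ c (is_derive1_comp (is_derive_expR (b * s)) db).
  by rewrite /GRing.scale /= (mulrC _ b) mulrA.
have ec : continuous (fun s => c * expR (b * s)).
  by move=> s; apply/differentiable_continuous/derivable1_diffP; case: (de s).
have main (f df : K -> K) : continuous f -> f 0 = 0 ->
    (forall t : K, 0 < t -> is_derive t (1 : K) f (df t)) ->
    (forall t : K, 0 <= t -> `|df t| <= c * b * expR (b * t)) ->
    f t <= c * expR (b * t).
  move=> fc f0 fd fb.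
  have [||s] := @MVT_segment K (fun s => c * expR (b * s) - f s)
    (fun s => c * b * expR (b * s) - df s) 0 t t0.
  - move=> s; rewrite in_itv /= => /andP[s0 _].
    by apply: is_deriveB; exact: fd.
  - by apply: continuous_subspaceT => s; apply: cvgB; [exact: ec|exact: fc].
  rewrite in_itv /= => /andP[s0 _]; rewrite f0 mulr0 expR0.
  have : 0 <= c * b * expR (b * s) - df s.
    by rewrite subr_ge0; apply: le_trans (ler_norm _) (fb _ s0).
  by nra.
rewrite ler_norml; apply/andP; split; last exact: main gc g0 gd gb.
rewrite lerNl; apply: (main (fun s => - g s) (fun s => - dg s)).
- by move=> s; apply: cvgN; exact: gc.
- by rewrite g0 oppr0.
- by move=> s s0; apply: is_deriveN; exact: gd.
- by move=> s s0; rewrite normrN; exact: gb.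
Qed.

End Derivatives.

Section Picard.
Context {K : realType} {m n : nat} (F : 'M[K]_(m, n) -> 'M[K]_(m, n)) (c : K)
  (x0 : 'M[K]_(m, n)).
Hypotheses (c0 : 0 < c) (Flip : forall x y, `|F x - F y| <= c * `|x - y|).

Lemma lipschitz_continuous : continuous F.
Proof.
move=> x; apply/(@cvgrPdist_le _ _ _ (nbhs x)) => e e0; near=> y.
apply: le_trans (Flip _ _) _; rewrite mulrC -ler_pdivlMr//.
near: y; apply: cvgr_dist_le; first exact: cvg_id.
exact: divr_gt0.
Unshelve. all: by end_near. Qed.

(** Integration from the base point [0], frozen at negative times. *)
Lemma picard_step (Y : K -> 'M[K]_(m, n)) : exists Z : K -> 'M[K]_(m, n),
  continuous Y -> [/\ continuous Z, forall t, t <= 0 -> Z t = x0 &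
    forall t : K, 0 < t -> is_derive t (1 : K) Z (F (Y t))].
Proof.
have [Yc|nYc] := pselect (continuous Y); last by exists Y.
have hc i j : continuous (fun t => F (Y t) i j).
  move=> t; apply: (continuous_mxP _ _).1 => //.
  by apply: (continuous_comp (Yc t)); exact: lipschitz_continuous.
have /choice[G HG] (ij : 'I_m * 'I_n) : exists G : K -> K, G 0 = 0 /\
    forall t : K, -1 < t -> is_derive t (1 : K) G (F (Y t) ij.1 ij.2).
  by have [G G0 GD] := antiderivative (hc ij.1 ij.2); exists G.
pose g i j t : K := x0 i j + G (i, j) t.
have gd i j (t : K) : -1 < t -> is_derive t (1 : K) (g i j) (F (Y t) i j).
  move=> t1; rewrite -[F _ _ _]add0r; apply: is_deriveD.
  exact: (HG (i, j)).2.
exists (fun t => \matrix_(i, j) g i j (Num.max t 0)) => _; split.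
- move=> t; apply/continuous_mxP => i j.
  rewrite (_ : (fun s => _) = fun s => g i j (Num.max s 0)); last first.
    by apply/funext => s; rewrite mxE.
  have maxc : {for t, continuous (fun s : K => Num.max s 0)}.
    by apply: continuous_max; [exact: cvg_id|exact: cvg_cst].
  apply: (continuous_comp maxc).
  have /(gd i j)[] : -1 < Num.max t 0 by rewrite lt_max ltrN10 orbT.
  by move=> /derivable1_diffP/differentiable_continuous.
- move=> t t0; apply/matrixP => i j; rewrite !mxE (max_idPr t0) /g.
  by rewrite (HG (i, j)).1 addr0.
- move=> t t0; apply/is_derive_mxP => i j.
  apply: (near_eq_is_derive (f := g i j)).
  - near=> s; rewrite mxE max_l//; apply: ltW.
    by near: s; exact: lt_nbhsr.
  - by apply: gd; apply: lt_trans t0; rewrite ltrN10.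
Unshelve. all: by end_near. Qed.

(** Picard iteration contracts by 1/2 in the norm weighted by [e^(-2ct)], so no
    restriction on the length of the time interval is needed. *)
Theorem picard : exists X : K -> 'M[K]_(m, n), [/\ continuous X, X 0 = x0 &
  forall t : K, 0 < t -> is_derive t (1 : K) X (F (X t))].
Proof.
have /choice[op Hop] := picard_step.
pose X j := iter j op (cst x0).
have Xc j : continuous (X j).
  elim: j => [|j IH]; first by move=> t; exact: cvg_cst.
  by have [] := Hop _ IH.
have XN j t : t <= 0 -> X j t = x0.
  by case: j => [//|j] t0; have [_ H _] := Hop _ (Xc j); exact: H.
have Xd j (t : K) : 0 < t -> is_derive t (1 : K) (X j.+1) (F (X j t)).
  by move=> t0; have [_ _ H] := Hop _ (Xc j); exact: H.
pose b := 2 * c; have b0 : 0 < b by rewrite mulr_gt0.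
pose w t : K := expR (b * Num.max t 0).
have w_gt0 t : 0 < w t by exact: expR_gt0.
have weighted (U V dU dV : K -> 'M[K]_(m, n)) (a : K) : 0 <= a ->
    continuous U -> continuous V ->
    (forall t, t <= 0 -> U t = x0) -> (forall t, t <= 0 -> V t = x0) ->
    (forall t : K, 0 < t -> is_derive t (1 : K) U (dU t)) ->
    (forall t : K, 0 < t -> is_derive t (1 : K) V (dV t)) ->
    (forall t, 0 <= t -> `|dU t - dV t| <= a * b * w t) ->
    forall t, `|U t - V t| <= a * w t.
  move=> a0 Uc Vc U0 V0 Ud Vd dUV t.
  have [t0|/ltW t0] := leP t 0.
    by rewrite U0// V0// subrr normr0 mulr_ge0// ltW.
  apply: mx_norm_le => [|i j]; first by rewrite mulr_ge0// ltW.
  rewrite !mxE /w (max_idPl t0).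
  apply: (@exp_growth K (fun t => U t i j - V t i j)
    (fun t => dU t i j - dV t i j) b a) => //.
  - move=> s; apply: cvgB; apply: (continuous_mxP _ _).1; [exact: Uc|exact: Vc].
  - by rewrite U0// V0// subrr.
  - move=> s s0; apply: is_deriveB; apply: (is_derive_mxP _ _ _).1;
      [exact: Ud|exact: Vd].
  - move=> s s0; have := dUV s s0; rewrite /w (max_idPl s0); apply: le_trans.
    by have := mx_entry_le (dU s - dV s) i j; rewrite !mxE.
pose a := `|F x0| / b; have a0 : 0 <= a by rewrite divr_ge0// ltW.
have X_step j t : `|X j.+1 t - X j t| <= a * w t * 2 ^- j.
  rewrite mulrAC; elim: j t => [|j IH] t.
    rewrite expr0 invr1 mulr1.
    apply: (weighted _ _ (fun=> F x0) (fun=> 0)) => //.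
    - exact: XN.
    - move=> s s0; rewrite subr0 /a divfK ?gt_eqF// ler_peMr//.
      rewrite /w -expR0 ler_expR; apply: mulr_ge0; first exact: ltW.
      by rewrite le_max lexx orbT.
  apply: (weighted _ _ (fun t => F (X j.+1 t)) (fun t => F (X j t))) => //.
  - by rewrite mulr_ge0// invr_ge0 exprn_ge0.
  - exact: XN.
  - exact: XN.
  move=> s _; apply: le_trans (Flip _ _) _.
  apply: le_trans (ler_wpM2l (ltW c0) (IH s)) _.
  rewrite le_eqVlt; apply/orP; left; apply/eqP.
  by rewrite /b exprS invfM; field; rewrite expf_neq0.
have /choice[Y HY] (t : K) : exists y, forall j,
    `|y - X j t| <= 2 * (a * w t) * 2 ^- j.
  have /choice[y Hy] (p : 'I_m * 'I_n) : exists l, forall i,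
      `|l - X i t p.1 p.2| <= 2 * (a * w t) * 2 ^- i.
    apply: geometric_limit => [|i]; first by rewrite mulr_ge0// ltW.
    apply: le_trans (X_step i t).
    by have := mx_entry_le (X i.+1 t - X i t) p.1 p.2; rewrite !mxE.
  exists (\matrix_(i, j) y (i, j)) => i; apply: mx_norm_le => [|p q].
    by rewrite !mulr_ge0// ?invr_ge0 ?exprn_ge0// ltW.
  by rewrite !mxE; exact: (Hy (p, q)).
have small (M e : K) : 0 < e -> exists j, M * 2 ^- j <= e.
  move=> e0; exists (Num.bound `|M / e|).
  rewrite ler_pdivrMr ?exprn_gt0// mulrC -ler_pdivrMr//.
  apply: le_trans (ler_norm _) _; apply/ltW/(lt_le_trans (archi_boundP _)) => //.
  by rewrite -natrX ler_nat; apply/ltnW; exact: ltn_expl.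
have Yc : continuous Y.
  move=> t; apply/cvgrPdist_le => e e0; have e3 : 0 < e / 3 by rewrite divr_gt0.
  have [j Hj] := small (2 * (a * w (t + 1))) _ e3.
  have near_Y s : s <= t + 1 -> `|Y s - X j s| <= e / 3.
    move=> st; apply: le_trans Hj; apply: le_trans (HY s j) _.
    rewrite ler_wpM2r ?invr_ge0 ?exprn_ge0// ler_wpM2l// ler_wpM2l//.
    rewrite /w ler_expR; apply: ler_wpM2l; first exact: ltW.
    by rewrite ge_max !le_max st lexx orbT.
  near=> s.
  have h1 : `|Y t - X j t| <= e / 3 by apply: near_Y; lra.
  have h2 : `|Y s - X j s| <= e / 3.
    apply: near_Y; apply: ltW; near: s; apply: lt_nbhsl; lra.
  have h3 : `|X j t - X j s| <= e / 3.
    by near: s; have /cvgrPdist_le := Xc j t; apply.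
  rewrite (_ : Y t - Y s = Y t - X j t + (X j t - X j s) - (Y s - X j s)).
    apply: le_trans (ler_normB _ _) _.
    have := ler_normD (Y t - X j t) (X j t - X j s); lra.
  by rewrite addrA subrK opprB addrA subrK.
have [Zc ZN Zd] := Hop _ Yc.
(* The limit is a fixed point: [X j.+1] is close both to [Y] and to [op Y]. *)
have ZY t : op Y t = Y t.
  apply/eqP; rewrite -subr_eq0 -normr_le0; apply/ler_addgt0Pl => e e0.
  rewrite addr0; have [j Hj] := small (2 * (a * w t)) _ e0.
  apply: le_trans Hj.
  rewrite (_ : op Y t - Y t = op Y t - X j.+1 t - (Y t - X j.+1 t)); last first.
    by rewrite opprB addrA subrK.
  have h1 : `|op Y t - X j.+1 t| <= a * 2 ^- j * w t.
    apply: (weighted _ _ (fun t => F (Y t)) (fun t => F (X j t))) => //.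
    - by rewrite mulr_ge0// invr_ge0 exprn_ge0.
    - exact: XN.
    move=> s _; apply: le_trans (Flip _ _) _.
    apply: le_trans (ler_wpM2l (ltW c0) (HY s j)) _.
    by rewrite le_eqVlt; apply/orP; left; apply/eqP; rewrite /b; ring.
  have h2 := HY t j.+1; apply: le_trans (ler_normB _ _) _.
  apply: le_trans (lerD h1 h2) _; rewrite le_eqVlt; apply/orP; left; apply/eqP.
  by rewrite exprS invfM; field; rewrite expf_neq0.
exists (op Y); split=> [//||t t0]; first exact: ZN.
by rewrite ZY; exact: Zd.
Unshelve. all: by end_near. Qed.

End Picard.

(** * Barriers around a solution of the Riccati equation *)

Section FirstContact.
Context {K : realType} {n : nat}.

Lemma is_derive_qf (X : K -> 'M[K]_n) (dX : 'M[K]_n) (t : K) (v : 'cV[K]_n) :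
  is_derive t (1 : K) X dX -> is_derive t (1 : K) (fun s => qf (X s) v) (qf dX v).
Proof.
move=> /is_derive_mxP Xd.
rewrite (_ : (fun s => _) = \sum_i \sum_j (fun s => v i 0 * X s i j * v j 0)).
  rewrite qfE; apply: is_derive_sum => i; apply: is_derive_sum => j.
  have := is_deriveZ (v i 0 * v j 0) (Xd i j).
  rewrite /GRing.scale /= (mulrAC (v i 0)).
  by congr is_derive; apply/funext => s; rewrite mulrAC.
apply/funext => s; rewrite qfE fct_sumE; apply: eq_bigr => i _.
by rewrite fct_sumE.
Qed.

(** A function that reaches zero from positive values does not increase there. *)
Lemma derive_le0_left (f : K -> K) (t df : K) : 0 < t ->
  is_derive t (1 : K) f df -> f t = 0 -> (forall s, 0 < s -> s < t -> 0 < f s) ->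
  df <= 0.
Proof.
move=> t0 [fd fE] ft fpos; rewrite leNgt; apply/negP => df0.
have : h^-1 *: (f (h *: (1 : K) + t) - f t) @[h --> (0 : K)^'] --> df.
  by rewrite -fE; exact: fd.
move=> /(cvgr_gt _)/(_ 0 df0) [e /= e0 He].
pose h := - Num.min (e / 2) (t / 2).
have [he ht] : - h <= e / 2 /\ - h <= t / 2.
  by rewrite opprK !ge_min !lexx orbT.
have h0 : h < 0 by rewrite oppr_lt0 lt_min !divr_gt0.
have h1 : ball_ Num.norm 0 e h by rewrite /ball_ /= sub0r normrN ltr0_norm//; lra.
have := He h h1 (ltr0_neq0 h0); rewrite ft subr0 /GRing.scale /= mulr1.
rewrite nmulr_rgt0 ?invr_lt0// ltNge => /negP; apply; apply/ltW/fpos; lra.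
Qed.

(** Compactness of the unit sphere gives a first time at which a positive
    family of functions on it vanishes. *)
Lemma first_contact (f : K * 'rV[K]_n -> K) (T : K) (u : 'rV[K]_n) :
  continuous f -> (forall w, sphere w -> 0 < f (0, w)) ->
  0 <= T -> sphere u -> f (T, u) <= 0 ->
  exists t w, [/\ 0 < t, sphere w, f (t, w) = 0,
    forall s v, 0 <= s -> s < t -> sphere v -> 0 < f (s, v) &
    forall v, sphere v -> 0 <= f (t, v)].
Proof.
move=> fc f0 T0 Su fT.
pose S : set (K * 'rV[K]_n) := `[0, T]%classic `*` sphere.
pose A := S `&` (f @^-1` [set x | x <= 0]).
have Ac : compact A.
  apply: compact_closedI.
    by apply: compact_setX; [exact: segment_compact|exact: compact_sphere].
  by apply: preimage_closed; [move=> x _; exact: fc|exact: closed_le].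
have A0 : A !=set0 by exists (T, u); split=> //; split=> //=; rewrite in_itv /= T0 lexx.
have [|[t w]] := @compact_EVT_min _ _ (fun p : K * 'rV[K]_n => p.1) A A0 Ac.
  by apply: continuous_subspaceT => p; exact: cvg_fst.
rewrite inE => -[[/= t_itv Sw] ft] tmin.
move: t_itv; rewrite in_itv /= => /andP[t0 tT].
have pos s v : 0 <= s -> s < t -> sphere v -> 0 < f (s, v).
  move=> s0 st Sv; rewrite ltNge; apply/negP => fs.
  have := tmin (s, v); rewrite inE /= leNgt st => H; apply: notF; apply: H.
  by split=> //; split=> //=; rewrite in_itv /= s0 (le_trans (ltW st)).
have tpos : 0 < t.
  rewrite lt_neqAle t0 andbT; apply/eqP => t00.
  by have : f (t, w) <= 0 := ft; rewrite -t00 leNgt f0.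
have nonneg v : sphere v -> 0 <= f (t, v).
  move=> Sv; rewrite leNgt; apply/negP => fv.
  have fvc : {for t, continuous (fun s => f (s, v))}.
    have pc : {for t, continuous (fun s : K => (s, v))}.
      exact: (cvg_pair cvg_id (cvg_cst v)).
    by apply: (continuous_comp pc); exact: fc.
  near t^'- => s.
  have s0 : 0 <= s by near: s; exact: nbhs_left_ge.
  have st : s < t by near: s; exact: nbhs_left_lt.
  have := pos s v s0 st Sv; rewrite ltNge => /negP; apply; apply: ltW; near: s.
  exact: (cvgr_lt _ (cvg_at_left_filter fvc)).
exists t, w; split=> //.
by apply/eqP; rewrite eq_le ft nonneg.
Unshelve. all: by end_near. Qed.

End FirstContact.

Section Tube.
Context {K : realType} {n k : nat} (A C : 'M[K]_n) (B D : 'M[K]_(n, k))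
  (L : 'M[K]_(k, n)) (Q : 'M[K]_n) (R : 'M[K]_k).
Hypotheses (Qsym : Q \is symmetricmx) (Rsym : R \is symmetricmx)
  (QLRpos : posdefmx (block_mx Q L^T L R)).

Local Notation phi := (riccati A B C D L Q R).
Local Notation gain := (gain C B D L R).
Local Notation clyap := (clyap A C B D).
Local Notation run_cost := (run_cost L Q R).

Context (Pb : 'M[K]_n) (m : K).
Hypotheses (Pbpos : posdefmx Pb) (phiPb : phi Pb = 0) (m0 : 0 <= m)
  (mS : forall v, m * qf Pb v <= qf (schur L Q R) v).

Let Pbpsd : psdmx Pb. Proof. exact: posdef_psd. Qed.

(** At a contact vector of the lower barrier, the gain of [X] turns
    [phi (l Pb)] into a lower bound for [phi X]. *)
Lemma lower_contact X (l : K) v : psdmx X -> 0 <= l <= 1 ->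
  (forall w, l * qf Pb w <= qf X w) -> qf X v = l * qf Pb v ->
  (1 - l) * m * qf Pb v <= qf (phi X) v.
Proof.
move=> Xp /andP[l0 l1] lX Xv; pose H := gain X.
have [[Xs _] [Ps _]] := (Xp, Pbpsd).
have h1 : 0 <= qf (clyap H X) v - l * qf (clyap H Pb) v.
  rewrite -qfZ -qfB -clyapZ -clyapB; apply: lyap_kernel => [|w|].
  - exact: symB Xs (symZ _ Ps).
  - by rewrite qfB qfZ subr_ge0.
  - by rewrite qfB qfZ Xv subrr.
have h2 := riccati_le A C B D Rsym QLRpos H v Pbpsd; rewrite phiPb qf0 in h2.
have h3 := run_cost_schur Rsym QLRpos H v.
rewrite (riccati_gain A C B D Rsym QLRpos v Xp) -/H.
have h4 := mS v.
have : (1 - l) * (m * qf Pb v) <= (1 - l) * qf (run_cost H) v.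
  by rewrite ler_wpM2l ?subr_ge0//; apply: le_trans h3.
have : 0 <= l * (qf (clyap H Pb) v + qf (run_cost H) v) by rewrite mulr_ge0.
lra.
Qed.

(** At the upper barrier the gain of [Pb] plays that role, since it bounds
    [phi X] from above. *)
Lemma upper_contact X (l : K) v : psdmx X -> 1 <= l ->
  (forall w, qf X w <= l * qf Pb w) -> qf X v = l * qf Pb v ->
  qf (phi X) v <= (1 - l) * m * qf Pb v.
Proof.
move=> Xp l1 lX Xv; pose H := gain Pb.
have [[Xs _] [Ps _]] := (Xp, Pbpsd).
have h1 : 0 <= l * qf (clyap H Pb) v - qf (clyap H X) v.
  rewrite -qfZ -qfB -clyapZ -clyapB; apply: lyap_kernel => [|w|].
  - exact: symB (symZ _ Ps) Xs.
  - by rewrite qfB qfZ subr_ge0.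
  - by rewrite qfB qfZ Xv subrr.
have h2 := riccati_gain A C B D Rsym QLRpos v Pbpsd; rewrite phiPb qf0 in h2.
have e : qf (clyap H Pb) v = - qf (run_cost H) v by rewrite /H; lra.
have h3 := run_cost_schur Rsym QLRpos H v; have h4 := mS v.
apply: le_trans (riccati_le A C B D Rsym QLRpos H v Xp) _.
have : (l - 1) * (m * qf Pb v) <= (l - 1) * qf (run_cost H) v.
  by rewrite ler_wpM2l ?subr_ge0//; apply: le_trans h3.
by move: h1; rewrite e; lra.
Qed.

(** At the first contact with a barrier the distance to it decreases along the
    contact vector, while the bounds on [phi] there and the slow decay of [s]
    make its derivative positive. The equation is only required of [X] inside
    the tube, so that the lemma also applies to modified vector fields. *)
Lemma tube (s ds : K -> K) (X : K -> 'M[K]_n) :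
  continuous X -> (forall t, 0 <= t -> X t \is symmetricmx) ->
  continuous s -> (forall t, 0 <= t -> 0 < s t) ->
  (forall t : K, 0 < t -> is_derive t (1 : K) s (ds t)) ->
  (forall t, 0 < t -> - ds t < (1 - expR (- s t)) * m) ->
  (forall v, v != 0 -> expR (- s 0) * qf Pb v < qf (X 0) v) ->
  (forall v, v != 0 -> qf (X 0) v < expR (s 0) * qf Pb v) ->
  (forall t : K, 0 < t -> psdmx (X t) ->
     (forall v, expR (- s t) * qf Pb v <= qf (X t) v <= expR (s t) * qf Pb v) ->
     is_derive t (1 : K) X (phi (X t))) ->
  forall t v, 0 <= t ->
    expR (- s t) * qf Pb v <= qf (X t) v <= expR (s t) * qf Pb v.
Proof.
move=> Xc Xs sc s0 sd slow Xlo Xhi dyn T v0 T0.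
pose lo t u := qf (X t) u - expR (- s t) * qf Pb u.
pose hi t u := expR (s t) * qf Pb u - qf (X t) u.
pose f (p : K * 'rV[K]_n) := Num.min (lo p.1 p.2^T) (hi p.1 p.2^T).
suff main : forall u, sphere u -> 0 < f (T, u).
  have [->|v00] := eqVneq v0 0; first by rewrite !qf0v !mulr0 lexx.
  have [u Su [a a0 ->]] := normalize_sphere v00.
  have := main u Su; rewrite /f lt_min /lo /hi !subr_gt0 => /andP[/ltW h1 /ltW h2].
  by rewrite !qfZv !(mulrCA _ (a ^+ 2)) !ler_pM2l ?exprn_gt0// h1 h2.
move=> u Su; rewrite ltNge; apply/negP => fu.
have qc (Y : K -> 'M[K]_n) : continuous Y ->
    continuous (fun p : K * 'rV[K]_n => qf (Y p.1) p.2^T).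
  move=> Yc p.
  apply: (@continuous_qf K n _ (fun p : K * 'rV[K]_n => Y p.1) (fun p => p.2^T)).
    move=> i j; apply: (@continuous_comp _ _ _ fst (fun t => Y t i j)).
      exact: cvg_fst.
    by apply: (continuous_mxP _ _).1; exact: Yc.
  move=> i; apply: (@continuous_comp _ _ _ snd (fun u : 'rV[K]_n => u^T i 0)).
    exact: cvg_snd.
  exact: continuous_tr_coord.
have expc (r : K -> K) : continuous r -> continuous (fun t => expR (r t)).
  by move=> rc t; apply: (continuous_comp (rc t)); exact: continuous_expR.
have fc : continuous f.
  have loc : continuous (fun p : K * 'rV[K]_n => lo p.1 p.2^T).
    rewrite (_ : (fun p => _) =
        fun p => qf (X p.1 - expR (- s p.1) *: Pb) p.2^T); last first.
      by apply/funext => q; rewrite qfB qfZ.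
    apply: (qc (fun t => X t - expR (- s t) *: Pb)) => t.
    apply: cvgB; first exact: Xc.
    apply: cvgZ; last exact: cvg_cst.
    by apply: (expc (fun t => - s t)) => x; apply: cvgN; exact: sc.
  have hic : continuous (fun p : K * 'rV[K]_n => hi p.1 p.2^T).
    rewrite (_ : (fun p => _) =
        fun p => qf (expR (s p.1) *: Pb - X p.1) p.2^T); last first.
      by apply/funext => q; rewrite qfB qfZ.
    apply: (qc (fun t => expR (s t) *: Pb - X t)) => t.
    apply: cvgB; last exact: Xc.
    by apply: cvgZ; [exact: expc|exact: cvg_cst].
  by move=> p; exact: continuous_min (loc p) (hic p).
have f0 w : sphere w -> 0 < f (0, w).
  move=> /sphere_neq0 w0; rewrite /f lt_min /lo /hi !subr_gt0 /=.
  by rewrite Xlo// Xhi.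
have [t [w [t0 Sw fw before at_t]]] := first_contact fc f0 T0 Su fu.
have w0 := sphere_neq0 Sw; have p0 : 0 < qf Pb w^T by case: Pbpos => _; apply.
have in_tube v : expR (- s t) * qf Pb v <= qf (X t) v <= expR (s t) * qf Pb v.
  have [->|v00] := eqVneq v 0; first by rewrite !qf0v !mulr0 lexx.
  have [x Sx [a a0 ->]] := normalize_sphere v00.
  have := at_t x Sx; rewrite /f le_min /lo /hi !subr_ge0 => /andP[h1 h2].
  by rewrite !qfZv !(mulrCA _ (a ^+ 2)) !ler_pM2l ?exprn_gt0// h1 h2.
have Xpsd : psdmx (X t).
  split=> [|v]; first exact/Xs/ltW.
  have /andP[h _] := in_tube v; apply: le_trans h.
  by rewrite mulr_ge0 ?expR_ge0// posdef_ge0.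
have Xd := dyn t t0 Xpsd in_tube.
have st := s0 t (ltW t0); have slt := slow t t0.
have lopos : 0 < expR (- s t) by exact: expR_gt0.
have hipos : 0 < expR (s t) by exact: expR_gt0.
have lohi : expR (s t) * expR (- s t) = 1 by rewrite -expRD subrr expR0.
have lo1 : expR (- s t) < 1 by rewrite expR_lt1 oppr_lt0.
have hi1 : 1 < expR (s t) by rewrite expR_gt1.
have qd := is_derive_qf w^T Xd.
have [lo_w|hi_w] : lo t w^T = 0 \/ hi t w^T = 0.
  move: fw; rewrite /f /=; case: (leP (lo t w^T)) => _; by [left|right].
- have contact : (1 - expR (- s t)) * m * qf Pb w^T <= qf (phi (X t)) w^T.
    apply: lower_contact => //; first by rewrite (ltW lopos) (ltW lo1).
      by move=> v; case/andP: (in_tube v).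
    by apply/eqP; rewrite -subr_eq0; apply/eqP.
  have ed : is_derive t (1 : K) (fun r => lo r w^T)
      (qf (phi (X t)) w^T - qf Pb w^T * (expR (- s t) * - ds t)).
    apply: is_deriveB; rewrite (_ : (fun r => _) =
      qf Pb w^T \*: (expR \o (fun r => - s r))); last first.
      by apply/funext => r; rewrite mulrC.
    apply: is_deriveZ; apply: is_derive1_comp.
    by apply: is_deriveN; exact: sd.
  have : qf (phi (X t)) w^T - qf Pb w^T * (expR (- s t) * - ds t) <= 0.
    apply: (derive_le0_left t0 ed lo_w) => r r0 rt.
    by have := before r w (ltW r0) rt Sw; rewrite /f lt_min => /andP[].
  have h1 : expR (- s t) * - ds t < expR (- s t) * ((1 - expR (- s t)) * m).
    by rewrite ltr_pM2l.
  have h2 : expR (- s t) * ((1 - expR (- s t)) * m) <= (1 - expR (- s t)) * m.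
    by apply: ler_piMl; [rewrite mulr_ge0// subr_ge0|]; exact: ltW.
  have h3 : qf Pb w^T * (expR (- s t) * - ds t) <
      qf Pb w^T * ((1 - expR (- s t)) * m).
    by rewrite ltr_pM2l// (lt_le_trans h1).
  lra.
- have contact : qf (phi (X t)) w^T <= (1 - expR (s t)) * m * qf Pb w^T.
    apply: upper_contact => //; first exact: ltW.
      by move=> v; case/andP: (in_tube v).
    by apply/esym/eqP; rewrite -subr_eq0; apply/eqP.
  have ed : is_derive t (1 : K) (fun r => hi r w^T)
      (qf Pb w^T * (expR (s t) * ds t) - qf (phi (X t)) w^T).
    apply: is_deriveB; rewrite (_ : (fun r => _) =
      qf Pb w^T \*: (expR \o s)); last by apply/funext => r; rewrite mulrC.
    by apply: is_deriveZ; apply: is_derive1_comp; exact: sd.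
  have : qf Pb w^T * (expR (s t) * ds t) - qf (phi (X t)) w^T <= 0.
    apply: (derive_le0_left t0 ed hi_w) => r r0 rt.
    by have := before r w (ltW r0) rt Sw; rewrite /f lt_min => /andP[].
  have h1 : expR (s t) * - ds t < (expR (s t) - 1) * m.
    have : expR (s t) * - ds t < expR (s t) * ((1 - expR (- s t)) * m).
      by rewrite ltr_pM2l.
    by rewrite mulrA mulrBr mulr1 lohi.
  have h3 : qf Pb w^T * (expR (s t) * - ds t) < qf Pb w^T * ((expR (s t) - 1) * m).
    by rewrite ltr_pM2l.
  lra.
Qed.

End Tube.

(** * The Thompson metric *)

Section Thompson.
Context {K : realType} {n : nat}.
Implicit Types (X Y P : 'M[K]_n) (v : 'cV[K]_n).

Lemma loewner_leP X Y : X \is symmetricmx -> Y \is symmetricmx ->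
  loewner_le X Y <-> forall v, qf X v <= qf Y v.
Proof.
move=> Xs Ys; split=> [[_ H] v|H]; first by rewrite -subr_ge0 -qfB; exact: H.
by split=> [|v]; [exact: symB|rewrite -/(qf _ _) qfB subr_ge0].
Qed.

Lemma ratio_infP X Y v : X \is symmetricmx -> posdefmx Y ->
  qf X v <= ratio_inf X Y * qf Y v.
Proof.
move=> Xs Yp; have [Ys Y0] := Yp.
have [->|v0] := eqVneq v 0; first by rewrite !qf0v mulr0.
rewrite -ler_pdivrMr; last exact: Y0.
have leP t := loewner_leP Xs (symZ t Ys).
apply: lb_le_inf => [|t /leP/(_ v)]; last first.
  by rewrite qfZ ler_pdivrMr//; exact: Y0.
have [c c0 cY] := posdef_lower Yp; exists (n%:R * `|X| / c); apply/leP => w.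
apply: le_trans (ler_norm _) _; apply: le_trans (qf_norm_le _ _) _.
rewrite qfZ -[leRHS]mulrA; apply: ler_wpM2l; first by rewrite mulr_ge0.
by rewrite ler_pdivlMl.
Qed.

Lemma ratio_inf_le X Y v0 (t : K) : v0 != 0 -> X \is symmetricmx -> posdefmx Y ->
  (forall v, qf X v <= t * qf Y v) -> ratio_inf X Y <= t.
Proof.
move=> v00 Xs [Ys Y0] tX; have leP r := loewner_leP Xs (symZ r Ys).
apply: ge_inf; last by apply/leP => v; rewrite qfZ.
exists (qf X v0 / qf Y v0) => r /leP/(_ v0).
by rewrite qfZ ler_pdivrMr//; exact: Y0.
Qed.

Lemma ratio_supP X Y v : posdefmx X -> posdefmx Y ->
  ratio_sup X Y * qf Y v <= qf X v.
Proof.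
move=> Xp Yp; have [[Xs X0] [Ys Y0]] := (Xp, Yp).
have [->|v0] := eqVneq v 0; first by rewrite !qf0v mulr0.
rewrite -ler_pdivlMr; last exact: Y0.
have leP t := loewner_leP (symZ t Ys) Xs.
apply: sup_le_ub => [|t /leP/(_ v)]; last first.
  by rewrite qfZ ler_pdivlMr//; exact: Y0.
by exists 0; apply/leP => w; rewrite scale0r qf0 posdef_ge0.
Qed.

Lemma ratio_sup_gt0 X Y v0 : v0 != 0 -> posdefmx X -> posdefmx Y ->
  0 < ratio_sup X Y.
Proof.
move=> v00 Xp Yp; have [[Xs X0] [Ys Y0]] := (Xp, Yp).
have leP r := loewner_leP (symZ r Ys) Xs.
have [t tX [u u0 ut]] := qf_ratio_min X v00 Yp.
have t0 : 0 < t by rewrite -(pmulr_lgt0 _ (Y0 u u0)) -ut; exact: X0.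
apply: lt_le_trans t0 _; apply: ub_le_sup; last first.
  by apply/leP => v; rewrite qfZ.
exists (qf X v0 / qf Y v0) => r /leP/(_ v0).
by rewrite qfZ ler_pdivlMr//; exact: Y0.
Qed.

(** The maximum of the two ratios is at least one, because
    [P <= a Y <= a b P]; so the logarithm is nonnegative and the exponential
    inverts it. *)
Lemma thompsonP P Y v0 : v0 != 0 -> posdefmx P -> posdefmx Y ->
  0 <= thompson P Y /\ forall v,
    expR (- thompson P Y) * qf Y v <= qf P v <= expR (thompson P Y) * qf Y v.
Proof.
move=> v00 Pp Yp; have [[Ps P0] [Ys Y0]] := (Pp, Yp).
rewrite /thompson; set a := ratio_inf P Y; set b := ratio_inf Y P.
have aP v : qf P v <= a * qf Y v by exact: ratio_infP.
have bY v : qf Y v <= b * qf P v by exact: ratio_infP.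
set M := Num.max a b.
have M1 : 1 <= M.
  (* If both were below one, [P <= a Y < Y <= b P < P] at [v0]. *)
  rewrite leNgt gt_max; apply/negP => /andP[a1 b1].
  have := lt_le_trans (le_lt_trans (aP v0) _) (bY v0).
  rewrite gtr_pMl; last exact: Y0.
  move=> /(_ a1); rewrite ltNge => /negP; apply.
  by rewrite ger_pMl ?ltW//; exact: P0.
have M0 : 0 < M by lra.
split=> [|v]; first by rewrite ln_ge0.
have [p q] := (posdef_ge0 v Pp, posdef_ge0 v Yp).
rewrite expRN lnK ?posrE//; apply/andP; split.
  rewrite ler_pdivrMl//; apply: le_trans (bY v) _.
  by rewrite ler_wpM2r// le_max lexx orbT.
by apply: le_trans (aP v) _; rewrite ler_wpM2r// le_max lexx.
Qed.

Lemma thompson_le P Y v0 (s : K) : v0 != 0 -> posdefmx P -> posdefmx Y ->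
  (forall v, expR (- s) * qf Y v <= qf P v <= expR s * qf Y v) ->
  thompson P Y <= s.
Proof.
move=> v00 Pp Yp H; have [[Ps P0] [Ys Y0]] := (Pp, Yp).
have a1 : ratio_inf P Y <= expR s.
  by apply: (ratio_inf_le v00) => // v; case/andP: (H v).
have b1 : ratio_inf Y P <= expR s.
  apply: (ratio_inf_le v00) => // v; case/andP: (H v) => + _.
  by rewrite expRN ler_pdivrMl// expR_gt0.
rewrite /thompson -[leRHS]expRK ler_ln ?posrE ?expR_gt0//; first by rewrite ge_max a1.
rewrite lt_max; apply/orP; left.
rewrite -(pmulr_lgt0 _ (Y0 _ v00)); apply: lt_le_trans (P0 _ v00) _.
exact: ratio_infP.
Qed.

End Thompson.

(** The slopes of the chords of the concave function [1 - e^(-x)] from the origin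
    decrease; the tangent to the exponential at [- s] is compared with its
    values at [0] and [- d]. *)
Lemma expR_chord (K : realType) (s d : K) : 0 <= s <= d ->
  s * (1 - expR (- d)) <= d * (1 - expR (- s)).
Proof.
move=> /andP[s0 sd]; have es : 0 < expR (- s) by exact: expR_gt0.
have h1 : expR (- s) * (1 + s) <= 1.
  by rewrite expRN ler_pdivrMl ?expR_gt0// mulr1 expR_ge1Dx.
have h2 : expR (- s) * (1 + (s - d)) <= expR (- d).
  rewrite [in leRHS](_ : - d = - s + (s - d)); last by ring.
  by rewrite expRD ler_pM2l// expR_ge1Dx.
have : (d - s) * (expR (- s) * (1 + s)) <= (d - s) * 1.
  by rewrite ler_wpM2l// subr_ge0.
have : s * (expR (- s) * (1 + (s - d))) <= s * expR (- d) by rewrite ler_wpM2l.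
lra.
Qed.

(** * The Riccati flow and its contraction *)

Section Flow.
Context {K : realType} {n k : nat} (A C : 'M[K]_n) (B D : 'M[K]_(n, k))
  (L : 'M[K]_(k, n)) (Q : 'M[K]_n) (R : 'M[K]_k).
Hypotheses (Qsym : Q \is symmetricmx) (Rsym : R \is symmetricmx)
  (QLRpos : posdefmx (block_mx Q L^T L R)).

Local Notation phi := (riccati A B C D L Q R).

Context (Pb : 'M[K]_n) (v0 : 'cV[K]_n).
Hypotheses (v00 : v0 != 0) (Pbpos : posdefmx Pb) (phiPb : phi Pb = 0).

Let m : K := ratio_sup (schur L Q R) Pb.
Let schur_pos := schur_posdef Qsym Rsym QLRpos.
Let m0 : 0 < m. Proof. exact: ratio_sup_gt0 v00 schur_pos Pbpos. Qed.
Let mS v : m * qf Pb v <= qf (schur L Q R) v.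
Proof. exact: ratio_supP schur_pos Pbpos. Qed.

(** The closed ball of radius [s] around [Pb] for the Thompson metric. *)
Definition order_ball (s : K) : set 'M[K]_n := [set X | X \is symmetricmx /\
  forall v, expR (- s) * qf Pb v <= qf X v <= expR s * qf Pb v].

Lemma order_ball_posdef s X : order_ball s X -> posdefmx X.
Proof.
move=> [Xs X0]; split=> // v v1; have /andP[h _] := X0 v.
by apply: lt_le_trans h; rewrite mulr_gt0 ?expR_gt0//; case: Pbpos => _; apply.
Qed.

Lemma order_ball_bounded s X : order_ball s X ->
  `|X| <= expR s * (n%:R * `|Pb|).
Proof.
move=> Xs; have Xp := order_ball_posdef Xs.
apply: norm_le_qf => [||v]; first by case: Xp.
  by rewrite !mulr_ge0 ?expR_ge0.
rewrite ger0_norm ?posdef_ge0// -mulrA; have [_ /(_ v)/andP[_ h]] := Xs.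
apply: le_trans h _; rewrite ler_wpM2l ?expR_ge0//.
by apply: le_trans (ler_norm _) _; exact: qf_norm_le.
Qed.

(** Extending each entry of [phi] separately keeps symmetry, since the formula
    is the same for the entries [(i, j)] and [(j, i)]. *)
Lemma riccati_extension s : order_ball s !=set0 ->
  exists2 c : K, 0 < c & exists F : 'M[K]_n -> 'M[K]_n,
    [/\ forall X, order_ball s X -> F X = phi X,
        forall X Y, `|F X - F Y| <= c * `|X - Y| &
        forall X, F X \is symmetricmx].
Proof.
move=> ball0.
have [c c0 clip] := riccati_lipschitz A C B D Qsym Rsym QLRpos
  (expR s * (n%:R * `|Pb|)).
exists (c + 1); first by lra.
have lip i j X Y : order_ball s X -> order_ball s Y ->
    `|phi X i j - phi Y i j| <= (c + 1) * `|X - Y|.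
  move=> Xs Ys; apply: (@le_trans _ _ `|phi X - phi Y|).
    apply: le_trans (mx_entry_le (phi X - phi Y) i j).
    by move: (phi X) (phi Y) => U V; rewrite !mxE.
  have psd Z : order_ball s Z -> psdmx Z by move=> /order_ball_posdef/posdef_psd.
  apply: le_trans (clip X Y (psd _ Xs) (psd _ Ys) (order_ball_bounded Xs)
    (order_ball_bounded Ys)) _.
  by apply: ler_wpM2r => //; rewrite lerDl.
have c1 : 0 <= c + 1 by lra.
pose g i j X := inf [set phi Y i j + (c + 1) * `|X - Y| | Y in order_ball s].
have ext i j := lipschitz_extension c1 ball0 (@lip i j).
exists (fun X => \matrix_(i, j) g i j X); split=> [X Xs|X Y|X].
- by apply/matrixP => i j; rewrite mxE; exact: (ext i j).1.
- apply: mx_norm_le => [|i j]; first by rewrite mulr_ge0.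
  by rewrite !mxE; exact: (ext i j).2.
- apply/symmxP/matrixP => i j; rewrite !mxE /g; congr inf.
  apply: eq_imagel => Y /order_ball_posdef/posdef_psd Yp; congr (_ + _).
  by rewrite -{1}(symmxP _ (riccati_sym A C B D Qsym Rsym QLRpos Yp)) mxE.
Qed.

(** The skew part of [X] starts at zero and has zero derivative. *)
Lemma sym_flow (X F : K -> 'M[K]_n) : continuous X -> X 0 \is symmetricmx ->
  (forall t : K, 0 < t -> is_derive t (1 : K) X (F t)) ->
  (forall t, F t \is symmetricmx) -> forall t, 0 <= t -> X t \is symmetricmx.
Proof.
move=> Xc X0 Xd Fs t t0; apply/symmxP/matrixP => i j; rewrite mxE.
apply/eqP; rewrite -subr_eq0 -normr_le0 -(mul0r (expR (1 * t))).
apply: (@exp_growth K (fun t => X t j i - X t i j)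
  (fun t => F t j i - F t i j) 1 0) => //.
- by move=> s; apply: cvgB; apply: (continuous_mxP _ _).1; exact: Xc.
- by rewrite -[in X in X - _](symmxP _ X0) mxE subrr.
- by move=> s s0; apply: is_deriveB; apply: (is_derive_mxP _ _ _).1; exact: Xd.
- by move=> s s0; rewrite -[in X in X - _](symmxP _ (Fs s)) mxE subrr normr0 !mul0r.
Qed.

(** The solution of the extended equation cannot leave the order ball whose
    radius slightly exceeds [d_T(P, Pb)], by the tube lemma with constant [s]. *)
Lemma riccati_flow P : posdefmx P -> exists X, posdef_solution phi P X.
Proof.
move=> Pp; have [Ps _] := Pp; have [d0 Pd] := thompsonP v00 Pp Pbpos.
set d := thompson P Pb in d0 Pd; pose s := d + 1.
have s0 : 0 < s by rewrite /s; lra.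
have ds : d < s by rewrite /s; lra.
have inP v : v != 0 -> expR (- s) * qf Pb v < qf P v < expR s * qf Pb v.
  move=> v1; have /andP[h1 h2] := Pd v.
  have p0 : 0 < qf Pb v by case: Pbpos => _; apply.
  apply/andP; split; [apply: lt_le_trans h1|apply: le_lt_trans h2 _];
    by rewrite ltr_pM2r// ltr_expR// ltrN2.
have Pball : order_ball s P.
  split=> // v; have [->|/inP/andP[h1 h2]] := eqVneq v 0.
    by rewrite !qf0v !mulr0 lexx.
  by rewrite !ltW.
have [c c0 [F [FE Flip Fsym]]] := riccati_extension (ex_intro _ P Pball).
have [X [Xc X0 Xd]] := picard P c0 Flip.
have Xs t : 0 <= t -> X t \is symmetricmx.
  by apply: (sym_flow Xc _ Xd) => //; rewrite X0.
have in_ball t : 0 <= t -> order_ball s (X t).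
  move=> t0; split=> [|v]; first exact: Xs.
  apply: (@tube _ _ _ A C B D L Q R Rsym QLRpos Pb m Pbpos phiPb (ltW m0) mS
    (fun=> s) (fun=> 0) X) => //.
  - by move=> x; exact: cvg_cst.
  - by move=> r _; rewrite oppr0 mulr_gt0// subr_gt0 expR_lt1 oppr_lt0.
  - by move=> w /inP/andP[]; rewrite X0.
  - by move=> w /inP/andP[]; rewrite X0.
  - by move=> r r0 _ Xr; rewrite -FE; [exact: Xd|split=> //; exact/Xs/ltW].
exists X; split=> [//|t t0||t t0].
- exact/order_ball_posdef/in_ball.
- exact: continuous_subspaceT.
- by rewrite -FE; [exact: Xd|exact/in_ball/ltW].
Qed.

(** Freezing a solution at negative times turns continuity within the half-line
    into plain continuity. *)
Lemma continuous_clamp (X : K -> 'M[K]_n) :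
  {within [set t : K | 0 <= t], continuous X} ->
  continuous (fun t : K => X (Num.max t 0)).
Proof.
move=> /subspace_continuousP Xc t.
have max0 (x : K) : [set t : K | 0 <= t] (Num.max x 0).
  by rewrite /= le_max lexx orbT.
have maxc : {for t, continuous (fun x : K => Num.max x 0)}.
  by apply: continuous_max; [exact: cvg_id|exact: cvg_cst].
apply: (cvg_comp _ _ _ (Xc _ (max0 t))) => U /maxc H.
have H' : nbhs t (fun x : K => 0 <= Num.max x 0 -> U (Num.max x 0)) := H.
by apply: (filterS _ H') => x; apply; exact: (max0 x).
Qed.

(** Running the tube lemma with the slightly larger radius [(1 + e) d] and the
    slightly smaller rate [(1 - e) alpha] leaves room for strict inequalities;
    then [e] decreases to 0. *)
Lemma riccati_contraction P X : posdefmx P -> P <> Pb ->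
  posdef_solution phi P X ->
  let d := thompson P Pb in
  let alpha := (1 - expR (- d)) / d * m in
  [/\ 0 < d, 0 < alpha & forall t, 0 <= t ->
    thompson (X t) Pb <= expR (- (alpha * t)) * d].
Proof.
move=> Pp PPb [X0 Xp Xw Xd] d alpha; have [Ps _] := Pp; have [Pbs _] := Pbpos.
have [d_ge0 Pd] := thompsonP v00 Pp Pbpos; rewrite -/d in d_ge0 Pd.
have d0 : 0 < d.
  rewrite lt_neqAle d_ge0 andbT; apply/eqP => dE; apply: PPb.
  apply: qf_inj => // v; apply/eqP; rewrite eq_le.
  by have := Pd v; rewrite -dE oppr0 expR0 !mul1r andbC.
have ed : 0 < 1 - expR (- d) by rewrite subr_gt0 expR_lt1 oppr_lt0.
have alpha0 : 0 < alpha by rewrite /alpha !mulr_gt0// invr_gt0.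
split=> // t t0.
suff approx e : 0 < e < 1 ->
    thompson (X t) Pb <= (1 + e) * d * expR (- (alpha * (1 - e) * t)).
  rewrite leNgt; apply/negP => lt_th.
  pose h e := (1 + e) * d * expR (- (alpha * (1 - e) * t)).
  have hc : {for (0 : K), continuous h}.
    have rc : {for (0 : K), continuous (fun e : K => - (alpha * (1 - e) * t))}.
      apply: cvgN; apply: cvgM; last exact: cvg_cst.
      apply: cvgM; first exact: cvg_cst.
      by apply: cvgB; [exact: cvg_cst|exact: cvg_id].
    have ec : {for (0 : K), continuous (fun e : K => expR (- (alpha * (1 - e) * t)))}.
      by apply: (continuous_comp rc); exact: continuous_expR.
    apply: cvgM; last exact: ec.
    apply: cvgM; last exact: cvg_cst.
    by apply: cvgD; [exact: cvg_cst|exact: cvg_id].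
  near (0 : K)^'+ => e.
  have e0 : 0 < e by near: e; exact: nbhs_right_gt.
  have e1 : e < 1 by near: e; exact: nbhs_right_lt.
  have := approx e; rewrite e0 e1 leNgt -/(h e) => /(_ isT)/negP; apply.
  near: e; apply: (cvgr_lt (h 0)).
    exact: cvg_at_right_filter.
  by rewrite /h addr0 subr0 mulr1 mul1r mulrC.
move=> /andP[e0 e1].
pose r := alpha * (1 - e).
have r0 : 0 < r by rewrite mulr_gt0// subr_gt0.
have D0 : 0 < (1 + e) * d by rewrite mulr_gt0// addr_gt0.
pose s x := (1 + e) * d * expR (- (r * x)).
have s0 x : 0 < s x by rewrite mulr_gt0 ?expR_gt0.
have sd x : is_derive x (1 : K) s (- r * s x).
  have lin : is_derive x (1 : K) (fun x => - (r * x)) (- r).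
    have := is_deriveN (is_deriveZ r (is_derive_id x (1 : K))).
    by rewrite /GRing.scale /= mulr1.
  have := is_deriveZ ((1 + e) * d) 
    (@is_derive1_comp _ expR (fun x => - (r * x)) x _ _ (is_derive_expR _) lin).
  move=> h; apply: (is_derive_eq h); rewrite /s /GRing.scale /=; ring.
have slow x : 0 < x -> - (- r * s x) < (1 - expR (- s x)) * m.
  move=> x0; have sD : 0 <= s x <= (1 + e) * d.
    rewrite ltW//=; apply: ler_piMr; first exact: ltW.
    by rewrite expR_le1 oppr_le0 mulr_ge0// ltW.
  have chord := expR_chord sD.
  have dD : 1 - expR (- d) <= 1 - expR (- ((1 + e) * d)).
    by rewrite lerD2l lerN2 ler_expR lerN2 ler_peMl// ?lerDl// ltW.
  have ad : alpha * d = (1 - expR (- d)) * m.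
    by rewrite /alpha; field; rewrite gt_eqF.
  have h1 : alpha * s x <= (1 + e) * ((1 - expR (- s x)) * m).
    rewrite -(ler_pM2r d0).
    apply: (@le_trans _ _ (s x * (1 - expR (- ((1 + e) * d))) * m)).
      rewrite mulrAC ad mulrC mulrA; apply: ler_wpM2r; first exact: ltW.
      by apply: ler_wpM2l => //; exact: ltW.
    apply: (@le_trans _ _ ((1 + e) * d * (1 - expR (- s x)) * m)).
      by apply: ler_wpM2r => //; exact: ltW.
    by rewrite le_eqVlt; apply/orP; left; apply/eqP; ring.
  have e1' : 0 < 1 + e by rewrite addr_gt0.
  rewrite -(ltr_pM2l e1'); apply: lt_le_trans h1.
  have := mulr_gt0 (mulr_gt0 alpha0 (s0 x)) (mulr_gt0 e0 e0).
  by rewrite /r; lra.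
have s_0 : d < s 0.
  by rewrite /s mulr0 oppr0 expR0 mulr1 ltr_pMl// ltrDl.
pose Y (x : K) := X (Num.max x 0).
have YX x : 0 <= x -> Y x = X x by move=> x0; rewrite /Y (max_idPl x0).
rewrite -(YX t t0); apply: (thompson_le v00) => //; first by rewrite YX//; exact: Xp.
move=> v; apply: (@tube _ _ _ A C B D L Q R Rsym QLRpos Pb m Pbpos phiPb (ltW m0) mS
    s (fun x => - r * s x) Y) => //.
- exact: continuous_clamp.
- by move=> x x0; rewrite YX//; case: (Xp x x0).
- by move=> x; have [/derivable1_diffP/differentiable_continuous] := sd x.
- move=> v1 v1n; rewrite YX// X0; case/andP: (Pd v1) => + _; apply: lt_le_trans.
  rewrite ltr_pM2r; last by case: Pbpos => _; apply.
  by rewrite ltr_expR ltrN2 s_0.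
- move=> v1 v1n; rewrite YX// X0; case/andP: (Pd v1) => _ /le_lt_trans; apply.
  rewrite ltr_pM2r; last by case: Pbpos => _; apply.
  by rewrite ltr_expR s_0.
- move=> x x0 _ _; rewrite YX ?ltW//.
  apply: (near_eq_is_derive (f := X)); last exact: Xd.
  near=> y; rewrite YX//; apply: ltW; near: y; exact: lt_nbhsr.
Unshelve. all: by end_near. Qed.

End Flow.

Theorem theorem5p6 (K : realType) (n k : nat)
    (A C : 'M[K]_n) (B D : 'M[K]_(n, k)) (L : 'M[K]_(k, n))
    (Q : 'M[K]_n) (R : 'M[K]_k)
    (Qsym : Q \is symmetricmx) (Rsym : R \is symmetricmx)
    (QLRpos : posdefmx (block_mx Q L^T L R)) :
  ((exists Pbar : 'M[K]_n,
      posdefmx Pbar /\ GARE_solution A B C D L Q R Pbar) <->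
   (exists P0 : 'M[K]_n,
      posdefmx P0 /\ loewner_le (riccati A B C D L Q R P0) 0)) /\
  (forall Pbar : 'M[K]_n,
     posdefmx Pbar -> GARE_solution A B C D L Q R Pbar ->
     (forall P : 'M[K]_n, posdefmx P -> P <> Pbar ->
        (exists X : K -> 'M[K]_n,
           posdef_solution (riccati A B C D L Q R) P X) /\
        (let dP := thompson P Pbar in
         let rate := (1 - expR (- dP)) / dP *
           ratio_sup (Q - L^T *m invmx R *m L) Pbar in
         exists alpha : K,
           [/\ rate <= alpha, 0 < rate &
               forall X : K -> 'M[K]_n,
                 posdef_solution (riccati A B C D L Q R) P X ->
                 forall t : K, 0 <= t ->
                   thompson (X t) Pbar <= expR (- (alpha * t)) * dP])) /\
     (forall P : 'M[K]_n,
        posdefmx P -> GARE_solution A B C D L Q R P -> P = Pbar)).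
Proof.
split.
  split=> [[P [Pp [phiP _]]]|[P0 [P0p [_ P0sub]]]].
    exists P; split=> //; rewrite /loewner_le phiP subr0.
    by split=> [|v]; [exact: sym0|rewrite -/(qf _ _) qf0].
  have [v|P Pp phiP] := @riccati_solvable _ _ _ A C B D L Q R Qsym Rsym QLRpos P0 P0p.
    by have := P0sub v; rewrite -/(qf _ _) sub0r qfN oppr_ge0.
  exists P; split=> //; split=> //.
  exact/(weight_posdef D Rsym QLRpos)/posdef_psd.
move=> Pb Pbp [phiPb _].
(* Distinct symmetric matrices live in positive dimension. *)
have nonzero P : posdefmx P -> P <> Pb -> exists v : 'cV[K]_n, v != 0.
  move=> [Ps _] PPb; apply: contrapT => triv; apply: PPb.
  apply: qf_inj => // [|v]; first by case: Pbp.
  have [->|v0] := eqVneq v 0; first by rewrite !qf0v.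
  by case: triv; exists v.
split=> [P Pp PPb|P Pp [phiP _]].
  have [v v0] := nonzero P Pp PPb.
  have [X HX] := riccati_flow Qsym Rsym QLRpos v0 Pbp phiPb Pp.
  split; first by exists X.
  have [_ rate0 _] := riccati_contraction Qsym Rsym QLRpos v0 Pbp phiPb Pp PPb HX.
  eexists; split; [exact: lexx|exact: rate0|move=> Y HY].
  by have [_ _] := riccati_contraction Qsym Rsym QLRpos v0 Pbp phiPb Pp PPb HY.
(* A second solution would be a constant flow, which does not contract. *)
apply: contrapT => PPb; have [v v0] := nonzero P Pp PPb.
have const : posdef_solution (riccati A B C D L Q R) P (cst P).
  split=> // [|t _]; last by rewrite phiP; exact: is_derive_cst.
  by apply: continuous_subspaceT => t; exact: cvg_cst.
have [d0 rate0 /(_ 1 ler01)] :=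
  riccati_contraction Qsym Rsym QLRpos v0 Pbp phiPb Pp PPb const.
by rewrite leNgt gtr_pMl// expR_lt1 oppr_lt0 mulr1 rate0.
Qed.
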